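(* Let $(A,\{\!\!\{-,-\}\!\!\})$ be a double quasi-Poisson algebra over the semisimple algebra $A_0=\oplus_{s\in I}\mathbb{C}e_s$. Assume that $\phi:A\to A$ is an involutive $\mathbb{C}$-linear anti-automorphism with $\phi(e_s)=e_s$ for all $s\in I$ and $(\phi\otimes\phi)(\{\!\!\{a,b\}\!\!\})=\{\!\!\{\phi(a),\phi(b)\}\!\!\}^\circ$ for all $a,b\in A$. For any dimension vector $\alpha\in\mathbb{N}^I$, $N=\sum_{s\in I}\alpha_s$, considering the involution $\tau$ on $\mathfrak{gl}_N$ given by transposition, the antisymmetric biderivation $\{-,-\}_{\phi,\mathrm{O}}$ on $\mathrm{Rep}^{\phi,\tau}(A,\alpha)$ uniquely determined by $$\{a_{ij},b_{kl}\}_{\phi,\mathrm{O}}=\tfrac12\{\!\!\{a,b\}\!\!\}_{kj,il}+\tfrac12\{\!\!\{\phi(a),b\}\!\!\}_{ki,jl},\qquad a,b\in A,\ 1\le i,j,k,l\le N,$$ is a quasi-Poisson bracket for the action of $\mathrm{O}_\alpha:=\prod_{s\in I}\mathrm{O}(\alpha_s)$. Furthermore, if $\Phi\in A^\times$ is a moment map (for $\{\!\!\{-,-\}\!\!\}$) chosen to satisfy $\phi(\Phi)\,\Phi=1$, then $\mathtt{X}(\Phi):\mathrm{Rep}^{\phi,\tau}(A,\alpha)\to\mathrm{O}_\alpha$ is a moment map for $\{-,-\}_{\phi,\mathrm{O}}$.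
   Context: Algebras are finitely generated, associative, unital over $\mathbb{C}$; $\otimes=\otimes_{\mathbb{C}}$. $I=\{1,\dots,|I|\}$ is finite, $A_0=\oplus_{s\in I}\mathbb{C}e_s$ with $e_se_t=\delta_{st}e_s$, $\sum_se_s=1$, and $A$ is an algebra over $A_0$. Double brackets. Write $d=d'\otimes d''\in A\otimes A$; $(d'\otimes d'')^\circ=d''\otimes d'$; $a\,d\,b=ad'\otimes d''b$; $a\ast d\ast b=d'b\otimes ad''$. A double bracket is a $\mathbb{C}$-bilinear map $\{\!\!\{-,-\}\!\!\}:A\times A\to A\otimes A$ with $\{\!\!\{a,b\}\!\!\}=-\{\!\!\{b,a\}\!\!\}^\circ$, $\{\!\!\{a,bc\}\!\!\}=\{\!\!\{a,b\}\!\!\}c+b\{\!\!\{a,c\}\!\!\}$, $\{\!\!\{bc,a\}\!\!\}=\{\!\!\{b,a\}\!\!\}\ast c+b\ast\{\!\!\{c,a\}\!\!\}$, and $\{\!\!\{e,a\}\!\!\}=0=\{\!\!\{a,e\}\!\!\}$ for $e\in A_0$. With $\{\!\!\{a,d\}\!\!\}_L=\{\!\!\{a,d'\}\!\!\}\otimes d''$ and $\tau_{(123)}(a_1\otimes a_2\otimes a_3)=a_3\otimes a_1\otimes a_2$, put $\{\!\!\{a,b,c\}\!\!\}=\{\!\!\{a,\{\!\!\{b,c\}\!\!\}\}\!\!\}_L+\tau_{(123)}\{\!\!\{b,\{\!\!\{c,a\}\!\!\}\}\!\!\}_L+\tau_{(123)}^2\{\!\!\{c,\{\!\!\{a,b\}\!\!\}\}\!\!\}_L$.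 It is quasi-Poisson if for all $a,b,c\in A$ $$\{\!\!\{a,b,c\}\!\!\}=\tfrac14\sum_{s\in I}\big(ce_sa\otimes e_sb\otimes e_s-ce_sa\otimes e_s\otimes be_s-ce_s\otimes ae_sb\otimes e_s+ce_s\otimes ae_s\otimes be_s-e_sa\otimes e_sb\otimes e_sc+e_sa\otimes e_s\otimes be_sc+e_s\otimes ae_sb\otimes e_sc-e_s\otimes ae_s\otimes be_sc\big).$$ A moment map is an invertible $\Phi=\sum_s\Phi_s$, $\Phi_s\in e_sAe_s$, with $\{\!\!\{\Phi_s,a\}\!\!\}=\frac12(ae_s\otimes\Phi_s-e_s\otimes\Phi_sa+a\Phi_s\otimes e_s-\Phi_s\otimes e_sa)$ for all $a\in A$, $s\in I$. Representation spaces. $\mathrm{Rep}(A,\alpha)$ is the affine scheme whose coordinate ring is generated by $a_{ij}$ ($a\in A$, $1\le i,j\le N$), linear in $a$, with $(ab)_{ij}=\sum_ra_{ir}b_{rj}$ and $(e_s)_{ij}=\delta_{ij}$ if $i,j\in\{\alpha_1+\dots+\alpha_{s-1}+1,\dots,\alpha_1+\dots+\alpha_s\}$, $0$ otherwise; $\mathtt{X}(a)=(a_{ij})$. $\mathbb{C}[\mathrm{Rep}^{\phi,\tau}(A,\alpha)]$ is the quotient by the ideal generated by all $\phi(a)_{ij}-a_{ji}$. Notation $(c\otimes d)_{kj,il}=c_{kj}d_{il}$. $\mathrm{O}_\alpha$, embedded block-diagonally in $\mathrm{GL}_N$, acts by $g\cdot\mathtt{X}(a)=g^{-1}\mathtt{X}(a)g$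 on coordinate functions, with infinitesimal action $\xi_M(\mathtt{X}(a))=[\mathtt{X}(a),\xi]$. Quasi-Poisson conventions. Let $G\subset\mathrm{GL}_N(\mathbb{C})$ be reductive with Lie algebra $\mathfrak g\subset\mathfrak{gl}_N$, trace form $\langle\xi,\eta\rangle=\mathrm{tr}(\xi\eta)$, basis $(F_a)$ of $\mathfrak g$ and dual basis $(\check F_a)$. Put $\psi^{\mathfrak g}=\frac1{12}\sum_{a,b,c}\langle\check F_a,[\check F_b,\check F_c]\rangle F_a\wedge F_b\wedge F_c$, with $x_1\wedge x_2\wedge x_3=\sum_{\sigma\in S_3}\mathrm{sgn}(\sigma)x_{\sigma(1)}\otimes x_{\sigma(2)}\otimes x_{\sigma(3)}$, and let $\psi^{\mathfrak g}_M$ be the trivector field obtained from the infinitesimal action $\xi\mapsto\xi_M$, where $\xi_M(f)(x)=\frac{d}{dt}|_{t=0}f(\exp(-t\xi)\cdot x)$. A $G$-invariant antisymmetric biderivation $\{-,-\}$ on $M$ is quasi-Poisson if $\{f,\{g,h\}\}+\{g,\{h,f\}\}+\{h,\{f,g\}\}=\frac12\psi^{\mathfrak g}_M(f,g,h)$. A moment map is a $G$-equivariant morphism $\Xi:M\to G$ (adjoint action on $G$) with $\{\Xi^*\mathcal{H},-\}=\frac12\sum_a\Xi^*((F_a^L+F_a^R)(\mathcal{H}))\,(\check F_a)_M$ for all functions $\mathcal{H}$ on $G$, where $\xi^L(\mathcal{H})(g)=\frac{d}{dt}|_{0}\mathcal{H}(ge^{t\xi})$, $\xi^R(\mathcal{H})(g)=\frac{d}{dt}|_0\mathcal{H}(e^{t\xi}g)$.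 *)

(* Defs.v *)
From HB Require Import structures.
From mathcomp Require Import all_boot all_order all_algebra perm.
From mathcomp Require Import boolp reals.
From mathcomp.real_closed Require Export complex.

Set Implicit Arguments.
Unset Strict Implicit.
Unset Printing Implicit Defensive.

Import GRing.Theory.
Local Open Scope ring_scope.
Local Open Scope quotient_scope.

(* The library's [algType] and [comAlgType] exclude the zero ring, but the     *)
(* coordinate ring of an empty representation scheme is zero. The scaling is a *)
(* separate field because a join of [pzRingType] and [lmodType] would have to  *)
(* be declared below the library's algebra structures; the module structure    *)
(* is attached to the carriers right after.                                    *)
HB.mixin Record isPzAlgebra (K : pzRingType) A of GRing.PzRing A := {
  pz_scale : K -> A -> A;
  pz_scaleA : forall k l x, pz_scale k (pz_scale l x) = pz_scale (k * l) x;
  pz_scale1 : left_id 1 pz_scale;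
  pz_scaleDr : right_distributive pz_scale +%R;
  pz_scaleDl : forall x, {morph pz_scale^~ x : k l / k + l};
  pz_scaleAl : forall k (x y : A), pz_scale k (x * y) = pz_scale k x * y;
  pz_scaleAr : forall k (x y : A), pz_scale k (x * y) = x * pz_scale k y
}.

#[short(type="pzAlgType")]
HB.structure Definition PzAlgebra (K : pzRingType) :=
  {A of GRing.PzRing A & isPzAlgebra K A}.

#[short(type="comPzAlgType")]
HB.structure Definition ComPzAlgebra (K : pzRingType) :=
  {A of GRing.ComPzRing A & PzAlgebra K A}.

HB.instance Definition _ (K : pzRingType) (A : pzAlgType K) :=
  GRing.Zmodule_isLmodule.Build K (PzAlgebra.sort A)
    (@pz_scaleA K A) (@pz_scale1 K A) (@pz_scaleDr K A) (@pz_scaleDl K A).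
HB.instance Definition _ (K : pzRingType) (A : comPzAlgType K) :=
  GRing.Lmodule.copy (ComPzAlgebra.sort A) (PzAlgebra.sort A).

Lemma pzscalerAl (K : pzRingType) (A : pzAlgType K) (k : K) (x y : A) :
  k *: (x * y) = (k *: x) * y.
Proof. exact: pz_scaleAl. Qed.

Lemma pzscalerAr (K : pzRingType) (A : pzAlgType K) (k : K) (x y : A) :
  k *: (x * y) = x * (k *: y).
Proof. exact: pz_scaleAr. Qed.

Definition alg_hom (K : pzRingType) (A B : pzAlgType K) (f : A -> B) : Prop :=
  linear f /\ monoid_morphism f.

Definition bilin (K : pzRingType) (U V W : lmodType K) (f : U -> V -> W) : Prop :=
  (forall v, linear (f^~ v)) /\ (forall u, linear (f u)).

Definition finitely_generated (K : pzRingType) (A : pzAlgType K) : Prop :=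
  exists gens : seq A, forall P : A -> Prop,
    {in gens, forall x, P x} -> P 1 ->
    (forall (k : K) x y, P x -> P y -> P (k *: x + y)) ->
    (forall x y, P x -> P y -> P (x * y)) ->
    forall x, P x.

(* Tensor products: formal linear expressions in the symbols u (x) v, modulo   *)
(* the least congruence containing the K-module axioms and bilinearity.        *)

Section Tensor.
Variables (K : pzRingType) (U V : lmodType K).

Inductive tterm : Type :=
| TPure of U & V
| TZero
| TOpp of tterm
| TAdd of tterm & tterm
| TScale of K & tterm.

Inductive tcong : tterm -> tterm -> Prop :=
| tc_refl s : tcong s s
| tc_sym s t : tcong s t -> tcong t s
| tc_trans s t r : tcong s t -> tcong t r -> tcong s r
| tc_opp s s' : tcong s s' -> tcong (TOpp s) (TOpp s')
| tc_add s s' t t' : tcong s s' -> tcong t t' -> tcong (TAdd s t) (TAdd s' t')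
| tc_scale k s s' : tcong s s' -> tcong (TScale k s) (TScale k s')
| tc_addA s t r : tcong (TAdd s (TAdd t r)) (TAdd (TAdd s t) r)
| tc_addC s t : tcong (TAdd s t) (TAdd t s)
| tc_add0 s : tcong (TAdd TZero s) s
| tc_addN s : tcong (TAdd (TOpp s) s) TZero
| tc_scaleA k l s : tcong (TScale k (TScale l s)) (TScale (k * l) s)
| tc_scale1 s : tcong (TScale 1 s) s
| tc_scaleDr k s t : tcong (TScale k (TAdd s t)) (TAdd (TScale k s) (TScale k t))
| tc_scaleDl s k l : tcong (TScale (k + l) s) (TAdd (TScale k s) (TScale l s))
| tc_pureDl u u' v : tcong (TPure (u + u') v) (TAdd (TPure u v) (TPure u' v))
| tc_pureDr u v v' : tcong (TPure u (v + v')) (TAdd (TPure u v) (TPure u v'))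
| tc_pureZl k u v : tcong (TPure (k *: u) v) (TScale k (TPure u v))
| tc_pureZr k u v : tcong (TPure u (k *: v)) (TScale k (TPure u v)).

HB.instance Definition _ := gen_eqMixin tterm.
HB.instance Definition _ := gen_choiceMixin tterm.

Definition tcongb (s t : tterm) : bool := `[< tcong s t >].

Lemma tcongb_refl : reflexive tcongb.
Proof. by move=> s; apply/asboolP; exact: tc_refl. Qed.

Lemma tcongb_sym : symmetric tcongb.
Proof. by move=> s t; apply/idP/idP => /asboolP h; apply/asboolP; exact: tc_sym. Qed.

Lemma tcongb_trans : transitive tcongb.
Proof.
by move=> t s r /asboolP h1 /asboolP h2; apply/asboolP; exact: tc_trans h1 h2.
Qed.

Canonical tcong_equiv := EquivRel tcongb tcongb_refl tcongb_sym tcongb_trans.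

Definition tensor : Type := {eq_quot tcong_equiv}.
HB.instance Definition _ := Choice.on tensor.
HB.instance Definition _ := EqQuotient.on tensor.

Definition tclass (s : tterm) : tensor := \pi_tensor s.

Lemma tclassE s t : tclass s = tclass t <-> tcong s t.
Proof. by split=> [/eqmodP/asboolP|h]; [|apply/eqmodP/asboolP]. Qed.

Lemma tclassK (x : tensor) : tclass (repr x) = x.
Proof. exact: reprK. Qed.

Lemma repr_tclass s : tcong (repr (tclass s)) s.
Proof. by apply/tclassE; rewrite tclassK. Qed.

Definition pure (u : U) (v : V) : tensor := tclass (TPure u v).
Definition tensor_zero : tensor := tclass TZero.
Definition tensor_opp (x : tensor) : tensor := tclass (TOpp (repr x)).
Definition tensor_add (x y : tensor) : tensor := tclass (TAdd (repr x) (repr y)).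
Definition tensor_scale (k : K) (x : tensor) : tensor := tclass (TScale k (repr x)).

Lemma tclass_opp s : tensor_opp (tclass s) = tclass (TOpp s).
Proof. by apply/tclassE/tc_opp/repr_tclass. Qed.
Lemma tclass_add s t : tensor_add (tclass s) (tclass t) = tclass (TAdd s t).
Proof. by apply/tclassE/tc_add; apply: repr_tclass. Qed.
Lemma tclass_scale k s : tensor_scale k (tclass s) = tclass (TScale k s).
Proof. by apply/tclassE/tc_scale/repr_tclass. Qed.

Let tE := (tclass_opp, tclass_add, tclass_scale).

Lemma tensor_addA : associative tensor_add.
Proof.
move=> x y z; rewrite -(tclassK x) -(tclassK y) -(tclassK z) !tE.
exact/tclassE/tc_addA.
Qed.
Lemma tensor_addC : commutative tensor_add.
Proof. by move=> x y; rewrite -(tclassK x) -(tclassK y) !tE; exact/tclassE/tc_addC. Qed.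
Lemma tensor_add0 : left_id tensor_zero tensor_add.
Proof. by move=> x; rewrite -(tclassK x) !tE; exact/tclassE/tc_add0. Qed.
Lemma tensor_addN : left_inverse tensor_zero tensor_opp tensor_add.
Proof. by move=> x; rewrite -(tclassK x) !tE; exact/tclassE/tc_addN. Qed.

HB.instance Definition _ := GRing.isZmodule.Build tensor
  tensor_addA tensor_addC tensor_add0 tensor_addN.

Lemma tensor_scaleA k l x :
  tensor_scale k (tensor_scale l x) = tensor_scale (k * l) x.
Proof. by rewrite -(tclassK x) !tE; exact/tclassE/tc_scaleA. Qed.
Lemma tensor_scale1 : left_id 1 tensor_scale.
Proof. by move=> x; rewrite -(tclassK x) !tE; exact/tclassE/tc_scale1. Qed.
Lemma tensor_scaleDr : right_distributive tensor_scale +%R.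
Proof.
move=> k x y; rewrite -(tclassK x) -(tclassK y) /GRing.add /= !tE.
exact/tclassE/tc_scaleDr.
Qed.
Lemma tensor_scaleDl x : {morph tensor_scale^~ x : k l / k + l}.
Proof.
move=> k l; rewrite -(tclassK x) [RHS]/GRing.add /= !tE.
exact/tclassE/tc_scaleDl.
Qed.

HB.instance Definition _ := GRing.Zmodule_isLmodule.Build K tensor
  tensor_scaleA tensor_scale1 tensor_scaleDr tensor_scaleDl.

Lemma tclassN s : - tclass s = tclass (TOpp s).
Proof. exact: tclass_opp. Qed.
Lemma tclassD s t : tclass s + tclass t = tclass (TAdd s t).
Proof. exact: tclass_add. Qed.
Lemma tclassZ k s : k *: tclass s = tclass (TScale k s).
Proof. exact: tclass_scale. Qed.

Lemma pure_bilin : bilin pure.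
Proof.
split=> [v k u u'|u k v v']; rewrite /pure tclassZ tclassD; apply/tclassE.
  exact: tc_trans (tc_pureDl _ _ _) (tc_add (tc_pureZl _ _ _) (tc_refl _)).
exact: tc_trans (tc_pureDr _ _ _) (tc_add (tc_pureZr _ _ _) (tc_refl _)).
Qed.

Fixpoint teval (W : lmodType K) (f : U -> V -> W) (s : tterm) : W :=
  match s with
  | TPure u v => f u v
  | TZero => 0
  | TOpp s => - teval f s
  | TAdd s t => teval f s + teval f t
  | TScale k s => k *: teval f s
  end.

(* The linear map sending u (x) v to f u v; only meaningful for bilinear f.    *)
Definition tlift (W : lmodType K) (f : U -> V -> W) (x : tensor) : W :=
  teval f (repr x).

Lemma teval_cong (W : lmodType K) (f : U -> V -> W) s t :
  bilin f -> tcong s t -> teval f s = teval f t.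
Proof.
move=> [fl fr]; elim=> //= {s t}.
- by move=> s t r _ -> _ ->.
- by move=> s s' _ ->.
- by move=> s s' t t' _ -> _ ->.
- by move=> k s s' _ ->.
- by move=> *; rewrite addrA.
- by move=> *; rewrite addrC.
- by move=> *; rewrite add0r.
- by move=> *; rewrite addNr.
- by move=> *; rewrite scalerA.
- by move=> *; rewrite scale1r.
- by move=> *; rewrite scalerDr.
- by move=> *; rewrite scalerDl.
- by move=> u u' v; have := fl v 1 u u'; rewrite !scale1r.
- by move=> u v v'; have := fr u 1 v v'; rewrite !scale1r.
- move=> k u v; have h0 : f 0 v = 0.
    by have := fl v (-1) 0 0; rewrite scaler0 addr0 scaleN1r addNr.
  by have := fl v k u 0; rewrite addr0 h0 addr0.
- move=> k u v; have h0 : f u 0 = 0.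
    by have := fr u (-1) 0 0; rewrite scaler0 addr0 scaleN1r addNr.
  by have := fr u k v 0; rewrite addr0 h0 addr0.
Qed.

Lemma tlift_pure (W : lmodType K) (f : U -> V -> W) u v :
  bilin f -> tlift f (pure u v) = f u v.
Proof. by move=> fb; exact: (teval_cong fb (repr_tclass (TPure u v))). Qed.

Lemma tlift_linear (W : lmodType K) (f : U -> V -> W) : bilin f -> linear (tlift f).
Proof.
move=> fb k x y; rewrite -(tclassK x) -(tclassK y) tclassZ tclassD.
by rewrite /tlift !(teval_cong fb (repr_tclass _)).
Qed.

Lemma tensor_ind (P : tensor -> Prop) :
  (forall u v, P (pure u v)) ->
  (forall (k : K) x y, P x -> P y -> P (k *: x + y)) -> forall x, P x.
Proof.
move=> Pp PD; have P0 : P 0.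
  by have := PD (-1) _ _ (Pp 0 0) (Pp 0 0); rewrite scaleN1r addNr.
move=> x; rewrite -(tclassK x); elim: (repr x) => {x}.
- exact: Pp.
- exact: P0.
- move=> s Ps; rewrite -tclassN.
  by rewrite -scaleN1r -[_ *: _]addr0; exact: PD.
- move=> s Ps t Pt; rewrite -tclassD.
  by rewrite -[tclass s]scale1r; exact: PD.
- move=> k s Ps; rewrite -tclassZ.
  by rewrite -[_ *: _]addr0; exact: PD.
Qed.

End Tensor.

Notation "u \ox v" := (pure u v) (at level 40, left associativity) : ring_scope.

(* Dual numbers B[eps]/(eps^2); the pair (b, b') stands for b + b' eps. For a  *)
(* regular function f and g(t) = exp(t xi), the derivative d/dt f(g(t)) at     *)
(* t = 0 is the eps-coefficient of f(exp(eps xi)), exp(eps xi) = 1 + eps xi.   *)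

Section DualNumbers.
Variables (K : pzRingType).

Definition dual (B : comPzAlgType K) : Type := (B * B)%type.

Variable B : comPzAlgType K.
HB.instance Definition _ := GRing.Lmodule.copy (dual B) (B * B)%type.

Definition dual_mul (x y : dual B) : dual B :=
  (x.1 * y.1, x.1 * y.2 + x.2 * y.1).

Lemma dual_mulA : associative dual_mul.
Proof.
move=> [a a'] [b b'] [c c']; congr (_, _) => /=; first by rewrite mulrA.
by rewrite mulrDr mulrDl !mulrA addrA.
Qed.
Lemma dual_mulC : commutative dual_mul.
Proof.
move=> [a a'] [b b']; congr (_, _) => /=; first by rewrite mulrC.
by rewrite addrC (mulrC a) (mulrC b).
Qed.
Lemma dual_mul1 : left_id ((1, 0) : dual B) dual_mul.
Proof. by move=> [a a']; rewrite /dual_mul /= !mul1r mul0r addr0. Qed.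
Lemma dual_mulDl : left_distributive dual_mul +%R.
Proof.
move=> [a a'] [b b'] [c c']; congr (_, _) => /=; first by rewrite mulrDl.
by rewrite !mulrDl addrACA.
Qed.

HB.instance Definition _ := GRing.Zmodule_isComPzRing.Build (dual B)
  dual_mulA dual_mulC dual_mul1 dual_mulDl.

Lemma dual_scaleAl (k : K) (x y : dual B) : k *: (x * y) = (k *: x) * y.
Proof.
case: x y => [a a'] [b b']; congr (_, _) => /=; first by rewrite pzscalerAl.
by rewrite scalerDr !pzscalerAl.
Qed.
Lemma dual_scaleAr (k : K) (x y : dual B) : k *: (x * y) = x * (k *: y).
Proof. by rewrite mulrC dual_scaleAl mulrC. Qed.

HB.instance Definition _ := isPzAlgebra.Build K (dual B)
  (@scalerA _ _) (@scale1r _ _) (@scalerDr _ _) (@scalerDl _ _)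
  dual_scaleAl dual_scaleAr.

Definition dual_inj (b : B) : dual B := (b, 0).
Definition eps_coef (x : dual B) : B := x.2.

Definition exp_eps (N : nat) (xi : 'M[K]_N) : 'M[dual B]_N :=
  1%:M + map_mx (fun k : K => (0, k *: (1 : B)) : dual B) xi.

End DualNumbers.

(* The commutative K-algebra presented by generators X and relations rel:      *)
(* polynomial expressions modulo the least congruence containing the axioms of *)
(* commutative K-algebras and rel.                                             *)

Section Presented.
Variables (K : pzRingType) (X : Type).

Inductive pterm : Type :=
| PVar of X
| PConst of K
| PAdd of pterm & pterm
| PMul of pterm & pterm.

Variable rel : pterm -> pterm -> Prop.

Inductive pcong : pterm -> pterm -> Prop :=
| pc_rel s t : rel s t -> pcong s t
| pc_refl s : pcong s s
| pc_sym s t : pcong s t -> pcong t s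
| pc_trans s t r : pcong s t -> pcong t r -> pcong s r
| pc_add s s' t t' : pcong s s' -> pcong t t' -> pcong (PAdd s t) (PAdd s' t')
| pc_mul s s' t t' : pcong s s' -> pcong t t' -> pcong (PMul s t) (PMul s' t')
| pc_constD k l : pcong (PConst (k + l)) (PAdd (PConst k) (PConst l))
| pc_constM k l : pcong (PConst (k * l)) (PMul (PConst k) (PConst l))
| pc_addA s t r : pcong (PAdd s (PAdd t r)) (PAdd (PAdd s t) r)
| pc_addC s t : pcong (PAdd s t) (PAdd t s)
| pc_add0 s : pcong (PAdd (PConst 0) s) s
| pc_addN s : pcong (PAdd (PMul (PConst (-1)) s) s) (PConst 0)
| pc_mulA s t r : pcong (PMul s (PMul t r)) (PMul (PMul s t) r)
| pc_mulC s t : pcong (PMul s t) (PMul t s)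
| pc_mul1 s : pcong (PMul (PConst 1) s) s
| pc_mulDl s t r : pcong (PMul (PAdd s t) r) (PAdd (PMul s r) (PMul t r)).

HB.instance Definition _ := gen_eqMixin pterm.
HB.instance Definition _ := gen_choiceMixin pterm.

Definition pcongb (s t : pterm) : bool := `[< pcong s t >].

Lemma pcongb_refl : reflexive pcongb.
Proof. by move=> s; apply/asboolP; exact: pc_refl. Qed.

Lemma pcongb_sym : symmetric pcongb.
Proof. by move=> s t; apply/idP/idP => /asboolP h; apply/asboolP; exact: pc_sym. Qed.

Lemma pcongb_trans : transitive pcongb.
Proof.
by move=> t s r /asboolP h1 /asboolP h2; apply/asboolP; exact: pc_trans h1 h2.
Qed.

Canonical pcong_equiv := EquivRel pcongb pcongb_refl pcongb_sym pcongb_trans.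

Definition presented : Type := {eq_quot pcong_equiv}.
HB.instance Definition _ := Choice.on presented.
HB.instance Definition _ := EqQuotient.on presented.

Definition pclass (s : pterm) : presented := \pi_presented s.

Lemma pclassE s t : pclass s = pclass t <-> pcong s t.
Proof. by split=> [/eqmodP/asboolP|h]; [|apply/eqmodP/asboolP]. Qed.

Lemma pclassK (x : presented) : pclass (repr x) = x.
Proof. exact: reprK. Qed.

Lemma repr_pclass s : pcong (repr (pclass s)) s.
Proof. by apply/pclassE; rewrite pclassK. Qed.

Definition gen (x : X) : presented := pclass (PVar x).
Definition pres_zero : presented := pclass (PConst 0).
Definition pres_one : presented := pclass (PConst 1).
Definition pres_scale (k : K) (x : presented) : presented :=
  pclass (PMul (PConst k) (repr x)).
Definition pres_opp (x : presented) : presented := pres_scale (-1) x.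
Definition pres_add (x y : presented) : presented := pclass (PAdd (repr x) (repr y)).
Definition pres_mul (x y : presented) : presented := pclass (PMul (repr x) (repr y)).

Lemma pclass_scale k s : pres_scale k (pclass s) = pclass (PMul (PConst k) s).
Proof. by apply/pclassE/pc_mul/repr_pclass/pc_refl. Qed.
Lemma pclass_add s t : pres_add (pclass s) (pclass t) = pclass (PAdd s t).
Proof. by apply/pclassE/pc_add; apply: repr_pclass. Qed.
Lemma pclass_mul s t : pres_mul (pclass s) (pclass t) = pclass (PMul s t).
Proof. by apply/pclassE/pc_mul; apply: repr_pclass. Qed.

Let pE := (pclass_scale, pclass_add, pclass_mul).

Lemma pres_addA : associative pres_add.
Proof.
move=> x y z; rewrite -(pclassK x) -(pclassK y) -(pclassK z) !pE.
exact/pclassE/pc_addA.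
Qed.
Lemma pres_addC : commutative pres_add.
Proof. by move=> x y; rewrite -(pclassK x) -(pclassK y) !pE; exact/pclassE/pc_addC. Qed.
Lemma pres_add0 : left_id pres_zero pres_add.
Proof. by move=> x; rewrite -(pclassK x) !pE; exact/pclassE/pc_add0. Qed.
Lemma pres_addN : left_inverse pres_zero pres_opp pres_add.
Proof. by move=> x; rewrite -(pclassK x) /pres_opp !pE; exact/pclassE/pc_addN. Qed.

HB.instance Definition _ := GRing.isZmodule.Build presented
  pres_addA pres_addC pres_add0 pres_addN.

Lemma pres_mulA : associative pres_mul.
Proof.
move=> x y z; rewrite -(pclassK x) -(pclassK y) -(pclassK z) !pE.
exact/pclassE/pc_mulA.
Qed.
Lemma pres_mulC : commutative pres_mul.
Proof. by move=> x y; rewrite -(pclassK x) -(pclassK y) !pE; exact/pclassE/pc_mulC. Qed.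
Lemma pres_mul1 : left_id pres_one pres_mul.
Proof. by move=> x; rewrite -(pclassK x) !pE; exact/pclassE/pc_mul1. Qed.
Lemma pres_mulDl : left_distributive pres_mul +%R.
Proof.
move=> x y z; rewrite -(pclassK x) -(pclassK y) -(pclassK z) /GRing.add /= !pE.
exact/pclassE/pc_mulDl.
Qed.

HB.instance Definition _ := GRing.Zmodule_isComPzRing.Build presented
  pres_mulA pres_mulC pres_mul1 pres_mulDl.

Lemma pres_scaleE k x : pres_scale k x = pclass (PConst k) * x.
Proof. by rewrite -(pclassK x) /GRing.mul /= !pE. Qed.

Lemma pres_scaleA k l x : pres_scale k (pres_scale l x) = pres_scale (k * l) x.
Proof.
rewrite !pres_scaleE mulrA; congr (_ * _).
by rewrite /GRing.mul /= pE; apply/pclassE/pc_sym/pc_constM.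
Qed.
Lemma pres_scale1 : left_id 1 pres_scale.
Proof. by move=> x; rewrite pres_scaleE mul1r. Qed.
Lemma pres_scaleDr : right_distributive pres_scale +%R.
Proof. by move=> k x y; rewrite !pres_scaleE mulrDr. Qed.
Lemma pres_scaleDl x : {morph pres_scale^~ x : k l / k + l}.
Proof.
move=> k l; rewrite !pres_scaleE -mulrDl; congr (_ * _).
by rewrite [RHS]/GRing.add /= pE; apply/pclassE/pc_constD.
Qed.

HB.instance Definition _ := GRing.Zmodule_isLmodule.Build K presented
  pres_scaleA pres_scale1 pres_scaleDr pres_scaleDl.

Lemma pres_scaleAl (k : K) (x y : presented) : k *: (x * y) = (k *: x) * y.
Proof. by rewrite /GRing.scale /= !pres_scaleE mulrA. Qed.
Lemma pres_scaleAr (k : K) (x y : presented) : k *: (x * y) = x * (k *: y).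
Proof. by rewrite /GRing.scale /= !pres_scaleE mulrCA. Qed.

HB.instance Definition _ := isPzAlgebra.Build K presented
  pres_scaleA pres_scale1 pres_scaleDr pres_scaleDl
  pres_scaleAl pres_scaleAr.

Lemma pclassD s t : pclass s + pclass t = pclass (PAdd s t).
Proof. exact: pclass_add. Qed.
Lemma pclassM s t : pclass s * pclass t = pclass (PMul s t).
Proof. exact: pclass_mul. Qed.
Lemma pclassZ k s : k *: pclass s = pclass (PMul (PConst k) s).
Proof. exact: pclass_scale. Qed.

Fixpoint peval (S : pzAlgType K) (v : X -> S) (s : pterm) : S :=
  match s with
  | PVar x => v x
  | PConst k => k *: (1 : S)
  | PAdd s t => peval v s + peval v t
  | PMul s t => peval v s * peval v t
  end.

(* The algebra morphism with gen x |-> v x; only meaningful when v satisfies   *)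
(* the relations.                                                              *)
Definition plift (S : pzAlgType K) (v : X -> S) (f : presented) : S :=
  peval v (repr f).

Lemma peval_cong (S : comPzAlgType K) (v : X -> S) s t :
  (forall s t, rel s t -> peval v s = peval v t) ->
  pcong s t -> peval v s = peval v t.
Proof.
move=> hv; elim=> //= {s t}.
- by move=> s t r _ -> _ ->.
- by move=> s s' t t' _ -> _ ->.
- by move=> s s' t t' _ -> _ ->.
- by move=> k l; rewrite scalerDl.
- by move=> k l; rewrite -pzscalerAl mul1r scalerA.
- by move=> *; rewrite addrA.
- by move=> *; rewrite addrC.
- by move=> *; rewrite scale0r add0r.
- by move=> s; rewrite -pzscalerAl mul1r scaleN1r addNr scale0r.
- by move=> *; rewrite mulrA.
- by move=> *; rewrite mulrC.
- by move=> *; rewrite scale1r mul1r.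
- by move=> *; rewrite mulrDl.
Qed.

Lemma plift_gen (S : comPzAlgType K) (v : X -> S) x :
  (forall s t, rel s t -> peval v s = peval v t) -> plift v (gen x) = v x.
Proof. by move=> hv; exact: (peval_cong hv (repr_pclass (PVar x))). Qed.

Lemma plift_alg_hom (S : comPzAlgType K) (v : X -> S) :
  (forall s t, rel s t -> peval v s = peval v t) -> alg_hom (plift v).
Proof.
move=> hv; split=> [k x y|]; last first.
  split; first by rewrite /plift (peval_cong hv (repr_pclass _)) /= scale1r.
  move=> x y; rewrite -(pclassK x) -(pclassK y) pclassM.
  by rewrite /plift !(peval_cong hv (repr_pclass _)).
rewrite -(pclassK x) -(pclassK y) pclassZ pclassD.
by rewrite /plift !(peval_cong hv (repr_pclass _)) /= -pzscalerAl mul1r.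
Qed.

Lemma pres_ind (P : presented -> Prop) :
  (forall x, P (gen x)) -> P 1 ->
  (forall (k : K) x y, P x -> P y -> P (k *: x + y)) ->
  (forall x y, P x -> P y -> P (x * y)) -> forall x, P x.
Proof.
move=> Pg P1 PD PM x; rewrite -(pclassK x); elim: (repr x) => {x}.
- exact: Pg.
- move=> k; have P0 : P 0 by have := PD (-1) _ _ P1 P1; rewrite scaleN1r addNr.
  have -> : pclass (PConst k) = k *: (1 : presented) + 0.
    by rewrite addr0 [k *: _]pres_scaleE mulr1.
  exact: PD.
- move=> s Ps t Pt; rewrite -pclassD.
  by rewrite -[pclass s]scale1r; exact: PD.
- by move=> s Ps t Pt; rewrite -pclassM; exact: PM.
Qed.

End Presented.

Arguments PConst {K X}.

Section DoubleBrackets.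
Variables (K : fieldType) (A : pzAlgType K) (n : nat) (e : 'I_n -> A).
Local Notation T2 := (tensor A A).
Local Notation T3 := (tensor (tensor A A) A).

Definition idempotent_decomposition : Prop :=
  (forall s t, e s * e t = if s == t then e s else 0) /\ \sum_s e s = 1.

Definition tswap (d : T2) : T2 := tlift (fun d1 d2 : A => d2 \ox d1) d.
Definition outer (a : A) (d : T2) (b : A) : T2 :=
  tlift (fun d1 d2 : A => (a * d1) \ox (d2 * b)) d.
Definition inner (a : A) (d : T2) (b : A) : T2 :=
  tlift (fun d1 d2 : A => (d1 * b) \ox (a * d2)) d.
Definition tmap2 (f : A -> A) (d : T2) : T2 := tlift (fun d1 d2 : A => f d1 \ox f d2) d.
Definition tau123 (t : T3) : T3 :=
  tlift (fun (d : T2) (a3 : A) => tlift (fun a1 a2 : A => a3 \ox a1 \ox a2) d) t.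

Definition double_bracket (dbr : A -> A -> T2) : Prop :=
  [/\ bilin dbr,
      forall a b, dbr a b = - tswap (dbr b a),
      forall a b c, dbr a (b * c) = outer 1 (dbr a b) c + outer b (dbr a c) 1,
      forall a b c, dbr (b * c) a = inner 1 (dbr b a) c + inner b (dbr c a) 1
    & forall (k : 'I_n -> K) a,
        dbr (\sum_s k s *: e s) a = 0 /\ dbr a (\sum_s k s *: e s) = 0].

Definition dbrL (dbr : A -> A -> T2) (a : A) (d : T2) : T3 :=
  tlift (fun d1 d2 : A => dbr a d1 \ox d2) d.

Definition triple_bracket (dbr : A -> A -> T2) (a b c : A) : T3 :=
  dbrL dbr a (dbr b c) + tau123 (dbrL dbr b (dbr c a))
  + tau123 (tau123 (dbrL dbr c (dbr a b))).

Definition double_quasi_poisson (dbr : A -> A -> T2) : Prop :=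
  double_bracket dbr /\
  forall a b c, triple_bracket dbr a b c =
    4%:R^-1 *: \sum_s
      (  (c * e s * a) \ox (e s * b) \ox e s
       - (c * e s * a) \ox e s \ox (b * e s)
       - (c * e s) \ox (a * e s * b) \ox e s
       + (c * e s) \ox (a * e s) \ox (b * e s)
       - (e s * a) \ox (e s * b) \ox (e s * c)
       + (e s * a) \ox e s \ox (b * e s * c)
       + e s \ox (a * e s * b) \ox (e s * c)
       - e s \ox (a * e s) \ox (b * e s * c)).

Definition double_moment_map (dbr : A -> A -> T2) (Phi : A) : Prop :=
  (exists Psi, Phi * Psi = 1 /\ Psi * Phi = 1) /\
  exists Phis : 'I_n -> A,
    [/\ Phi = \sum_s Phis s,
        forall s, exists x, Phis s = e s * x * e s
      & forall s a, dbr (Phis s) a = 2%:R^-1 *: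
          (  (a * e s) \ox Phis s - e s \ox (Phis s * a)
           + (a * Phis s) \ox e s - Phis s \ox (e s * a))].

Definition compatible_involution (dbr : A -> A -> T2) (phi : A -> A) : Prop :=
  [/\ linear phi,
      forall a b, phi (a * b) = phi b * phi a,
      involutive phi,
      forall s, phi (e s) = e s
    & forall a b, tmap2 phi (dbr a b) = tswap (dbr (phi a) (phi b))].

End DoubleBrackets.

Section Blocks.
Variables (n : nat) (alpha : 'I_n -> nat).

Definition total_dim : nat := (\sum_(s < n) alpha s)%N.

Definition in_block (s : 'I_n) (i : 'I_total_dim) : bool :=
  (\sum_(t < n | t < s) alpha t <= i < \sum_(t < n | t <= s) alpha t)%N.

Definition same_block (i j : 'I_total_dim) : bool :=
  [exists s, in_block s i && in_block s j].

Definition block_diagonal (K : pzRingType) (M : 'M[K]_total_dim) : Prop :=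
  forall i j, ~~ same_block i j -> M i j = 0.

Definition O_alpha (K : pzRingType) (g : 'M[K]_total_dim) : Prop :=
  block_diagonal g /\ g^T *m g = 1%:M.

Definition o_alpha (K : pzRingType) (xi : 'M[K]_total_dim) : Prop :=
  block_diagonal xi /\ xi^T = - xi.

End Blocks.

Section RepresentationScheme.
Variables (K : fieldType) (A : pzAlgType K) (n : nat) (e : 'I_n -> A).
Variables (phi : A -> A) (alpha : 'I_n -> nat).
Local Notation N := (total_dim alpha).
Local Notation X := (A * 'I_N * 'I_N)%type.
Local Notation coord a i j := (@PVar K X (a, i, j)).

Inductive rep_rel : pterm K X -> pterm K X -> Prop :=
| rep_add a b i j : rep_rel (coord (a + b) i j) (PAdd (coord a i j) (coord b i j))
| rep_scale k a i j : rep_rel (coord (k *: a) i j) (PMul (PConst k) (coord a i j))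
| rep_mul a b i j : rep_rel (coord (a * b) i j)
    (\big[@PAdd K X/PConst 0]_(r < N) PMul (coord a i r) (coord b r j))
| rep_idem s i j : rep_rel (coord (e s) i j)
    (PConst [&& i == j, in_block s i & in_block s j]%:R).

Inductive rep_phi_rel : pterm K X -> pterm K X -> Prop :=
| rep_phi_rep s t : rep_rel s t -> rep_phi_rel s t
| rep_phi_tau a i j : rep_phi_rel (coord (phi a) i j) (coord a j i).

Definition rep_phi_ring : comPzAlgType K :=
  ComPzAlgebra.clone K (presented rep_phi_rel) _.
Arguments rep_phi_ring : simpl never.

Definition a_ (a : A) (i j : 'I_N) : rep_phi_ring := gen rep_phi_rel (a, i, j).
Definition X_ (a : A) : 'M[rep_phi_ring]_N := \matrix_(i, j) a_ a i j.

(* d |-> d_{kj,il}, where (c (x) d)_{kj,il} = c_{kj} d_{il}                    *)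
Definition coord2 (k j i l : 'I_N) (d : tensor A A) : rep_phi_ring :=
  tlift (fun c d : A => a_ c k j * a_ d i l) d.

Definition rep_action (g : 'M[K]_N) : rep_phi_ring -> rep_phi_ring :=
  let toB := map_mx (fun k : K => k *: (1 : rep_phi_ring)) in
  plift (fun x : X => (toB (invmx g) *m X_ x.1.1 *m toB g) x.1.2 x.2).

(* [xi_M f](x) = d/dt f(exp(- t xi) . x), i.e. the derivative of exp(t xi) . f *)
Definition rep_inf_action (xi : 'M[K]_N) (f : rep_phi_ring) : rep_phi_ring :=
  eps_coef (plift (S := dual rep_phi_ring) (fun x : X =>
    (exp_eps _ (- xi) *m map_mx (@dual_inj _ _) (X_ x.1.1) *m exp_eps _ xi)
      x.1.2 x.2) f).

End RepresentationScheme.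
Arguments rep_phi_ring : simpl never.

Section OrthogonalGroup.
Variables (K : fieldType) (n : nat) (alpha : 'I_n -> nat).
Local Notation N := (total_dim alpha).
Local Notation X := ('I_N * 'I_N)%type.
Local Notation coord i j := (@PVar K X (i, j)).

Inductive O_rel : pterm K X -> pterm K X -> Prop :=
| O_block i j : ~~ same_block i j -> O_rel (coord i j) (PConst 0)
| O_orth i j : O_rel
    (\big[@PAdd K X/PConst 0]_(r < N) PMul (coord r i) (coord r j))
    (PConst (i == j)%:R).

Definition O_ring : comPzAlgType K := ComPzAlgebra.clone K (presented O_rel) _.
Arguments O_ring : simpl never.

Definition O_coord : 'M[O_ring]_N := \matrix_(i, j) gen O_rel (i, j).

(* (g . H)(h) = H(g^-1 h g)                                                    *)
Definition O_adjoint (g : 'M[K]_N) : O_ring -> O_ring :=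
  let toB := map_mx (fun k : K => k *: (1 : O_ring)) in
  plift (fun x : X => (toB (invmx g) *m O_coord *m toB g) x.1 x.2).

(* [xi^L H](g) = d/dt H(g exp(t xi)) and [xi^R H](g) = d/dt H(exp(t xi) g)     *)
Definition O_left (xi : 'M[K]_N) (H : O_ring) : O_ring :=
  eps_coef (plift (S := dual O_ring) (fun x : X =>
    (map_mx (@dual_inj _ _) O_coord *m exp_eps _ xi) x.1 x.2) H).
Definition O_right (xi : 'M[K]_N) (H : O_ring) : O_ring :=
  eps_coef (plift (S := dual O_ring) (fun x : X =>
    (exp_eps _ xi *m map_mx (@dual_inj _ _) O_coord) x.1 x.2) H).

End OrthogonalGroup.
Arguments O_ring : simpl never.

Section QuasiPoisson.
Variables (K : fieldType) (B : comPzAlgType K).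

Definition antisym_biderivation (br : B -> B -> B) : Prop :=
  [/\ bilin br,
      forall f g, br f g = - br g f,
      forall f g h, br f (g * h) = br f g * h + g * br f h
    & forall f g h, br (f * g) h = br f h * g + f * br g h].

Variables (N : nat) (G lieG : 'M[K]_N -> Prop).
Variables (act inf : 'M[K]_N -> B -> B).

Definition trace_dual_bases (m : nat) (F F' : m.-tuple 'M[K]_N) : Prop :=
  [/\ free F,
      forall xi, xi \in <<F>>%VS <-> lieG xi,
      forall a, lieG (tnth F' a)
    & forall a b, \tr (tnth F a *m tnth F' b) = (a == b)%:R].

Definition wedge3 (x1 x2 x3 : 'M[K]_N) (f g h : B) : B :=
  \sum_(s : 'S_3) (-1) ^+ s *
    \prod_(r < 3) inf (tnth [tuple x1; x2; x3] (s r)) (tnth [tuple f; g; h] r).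

Definition cartan_trivector (m : nat) (F F' : m.-tuple 'M[K]_N) (f g h : B) : B :=
  12%:R^-1 *: \sum_a \sum_b \sum_c
    \tr (tnth F' a *m (tnth F' b *m tnth F' c - tnth F' c *m tnth F' b))
    *: wedge3 (tnth F a) (tnth F b) (tnth F c) f g h.

Definition quasi_poisson (br : B -> B -> B) : Prop :=
  [/\ antisym_biderivation br,
      forall x, G x -> forall f h, br (act x f) (act x h) = act x (br f h)
    & forall m (F F' : m.-tuple 'M[K]_N), trace_dual_bases F F' ->
      forall f g h,
        br f (br g h) + br g (br h f) + br h (br f g)
        = 2%:R^-1 *: cartan_trivector F F' f g h].

(* H is the coordinate ring of G, actG the adjoint action on it, infL and infR *)
(* the vector fields xi^L and xi^R; Xi : H -> B is the comorphism of M -> G.   *)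
Definition moment_map (H : comPzAlgType K) (actG infL infR : 'M[K]_N -> H -> H)
    (br : B -> B -> B) (Xi : H -> B) : Prop :=
  [/\ alg_hom Xi,
      forall x, G x -> forall u, Xi (actG x u) = act x (Xi u)
    & forall m (F F' : m.-tuple 'M[K]_N), trace_dual_bases F F' ->
      forall u f, br (Xi u) f = 2%:R^-1 *:
        \sum_a Xi (infL (tnth F a) u + infR (tnth F a) u) * inf (tnth F' a) f].

End QuasiPoisson.

(* Main.v *)
(* Write th for the involution (a,i,j) |-> (phi a,j,i) of the indexed            *)
(* generators, which leaves a_ij unchanged in the coordinate ring, and           *)
(* M_x = [E_ji, X(a)] for x = (a,i,j), so that xi_M(a_ij) = tr(xi M_x). Since    *)
(* the double bracket is th-invariant, 4 times the Jacobiator of a_ij, b_kl,     *)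
(* c_uv is the sum over the four twists of x, y by th of differences of          *)
(* coordinates of triple brackets; these equal 1/4 of tr(M_x [M_y, M_z]), where  *)
(* only the diagonal blocks of the M's enter. As M_(th x) = - M_x^T, summing     *)
(* over the twists replaces the M's by their projections to o_alpha, and the     *)
(* result is the Cartan trivector, because the Casimir tensor of o_alpha for the *)
(* trace form is that projection. The same projection turns the double moment    *)
(* map property into that of X(Phi). All the identities are between derivations, *)
(* so that it suffices to compare them on generators.                            *)

Require Import Defs.
From HB Require Import structures.
From mathcomp Require Import all_boot all_order all_algebra perm.
From mathcomp Require Import boolp reals ring.

Set Implicit Arguments.
Unset Strict Implicit.
Unset Printing Implicit Defensive.

Import GRing.Theory.
Local Open Scope ring_scope.

(** * Linear maps and derivations along algebra morphisms *)

(** The coordinate ring is given by generators and relations. A derivation of it is therefore an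
    algebra morphism to the dual numbers lifting the identity ([dual_lift]), and it is determined by
    its values on the coordinates a_ij. This gives existence of the bracket: the prescribed values
    respect the relations in the second argument, hence by antisymmetry in the first
    ([rep_bracket_exists]). It also reduces the identities to coordinates, since each compares
    expressions that are derivations in every argument, possibly along a morphism.

    Jacobi identity. Bracketing coordinates averages over the twists a_ij -> phi(a)_ji.
    Compatibility of phi with the double bracket makes the unsymmetrized iterated bracket invariant
    under twisting all three arguments at once ([Q3_phi]). The Jacobiator thus becomes a sum over
    four twists of differences of two coordinates of triple brackets ([jacobi_coord]). The eight
    terms of the quasi-Poisson condition are the expansion of the trace of a product of three
    commutators ([mxtrace_grad3]). A twist acts on such a commutator by M -> -M^T, so the sum
    antisymmetrizes: [jacobi_asym] leaves 1/32 tr(U [V, W]), where U, V, W are the antisymmetrized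
    block parts.

    Cartan trivector. It equals 1/2 tr(G_f [G_g, G_h]), where G_f is the gradient of f for the trace
    form ([cartan_trivectorE]). The Casimir tensor of o_alpha acts as the trace-orthogonal
    projection ([casimir_o_alpha]), so the gradient of a_ij is U/2 ([moment_gradE]). With the factor
    1/2 of the quasi-Poisson condition, the constants agree: 1/2 * 1/2 * 1/8 = 1/32.

    Moment map. The double moment map property says that the unsymmetrized bracket of X(Phi) with
    b_kl is half the anticommutator of X(Phi) with a block part V ([D_moment]). Differentiating
    phi(Phi) Phi = 1 shows that the twisted half of the bracket contributes the same with -V^T in
    place of V ([D_phi_moment]). Their sum involves V - V^T, which the Casimir tensor again
    identifies with the right-hand side ([moment_map_bracket]). *)

Section LinearMaps.
Variables (K : pzRingType) (U V : lmodType K) (f : U -> V).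
Hypothesis lf : linear f.

Lemma linear_fun0 : f 0 = 0.
Proof. by have := lf (-1) 0 0; rewrite scaler0 addr0 scaleN1r addNr. Qed.
Lemma linear_funD x y : f (x + y) = f x + f y.
Proof. by have := lf 1 x y; rewrite !scale1r. Qed.
Lemma linear_funZ k x : f (k *: x) = k *: f x.
Proof. by have := lf k x 0; rewrite linear_fun0 !addr0. Qed.
Lemma linear_funN x : f (- x) = - f x.
Proof. by rewrite -scaleN1r linear_funZ scaleN1r. Qed.
Lemma linear_funB x y : f (x - y) = f x - f y.
Proof. by rewrite linear_funD linear_funN. Qed.
Lemma linear_fun_sum (I : Type) (r : seq I) (P : pred I) (F : I -> U) :
  f (\sum_(i <- r | P i) F i) = \sum_(i <- r | P i) f (F i).
Proof. exact: (big_morph f linear_funD linear_fun0). Qed.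
End LinearMaps.

Lemma linear_scaler (K : comPzRingType) (U V : lmodType K) (k : K) (f : U -> V) :
  linear f -> linear (fun x => k *: f x).
Proof. by move=> lf l x y; rewrite lf scalerDr !scalerA mulrC. Qed.

Lemma linear_add (K : pzRingType) (U V : lmodType K) (f g : U -> V) :
  linear f -> linear g -> linear (fun x => f x + g x).
Proof. by move=> lf lg l x y; rewrite lf lg scalerDr addrACA. Qed.

Lemma linear_sum (K : pzRingType) (U V : lmodType K) (I : Type) (r : seq I)
    (F : I -> U -> V) :
  (forall i, linear (F i)) -> linear (fun x => \sum_(i <- r) F i x).
Proof.
move=> lF k x y; rewrite scaler_sumr -big_split /=.
by apply: eq_bigr => i _; rewrite lF.
Qed.

Lemma bilin_sum2 (K : comPzRingType) (U V W : lmodType K) (f : U -> V -> W)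
    (I J : finType) (c : I -> J -> K) (u : I -> J -> U) (d : I -> J -> K)
    (v : I -> J -> V) : bilin f ->
  f (\sum_p \sum_q c p q *: u p q) (\sum_r \sum_s d r s *: v r s)
  = \sum_p \sum_q \sum_r \sum_s (c p q * d r s) *: f (u p q) (v r s).
Proof.
move=> [lf lf']; rewrite (linear_fun_sum (lf _)); apply: eq_bigr => p _.
rewrite (linear_fun_sum (lf _)); apply: eq_bigr => q _.
rewrite (linear_fun_sum (lf' _)); apply: eq_bigr => r _.
rewrite (linear_fun_sum (lf' _)); apply: eq_bigr => s _.
by rewrite (linear_funZ (lf _)) (linear_funZ (lf' _)) scalerA.
Qed.

Lemma alg_hom_comp (K : pzRingType) (A B C : pzAlgType K) (f : B -> C)
    (g : A -> B) : alg_hom f -> alg_hom g -> alg_hom (f \o g).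
Proof.
move=> [lf [f1 fM]] [lg [g1 gM]]; split=> [k x y|]; first by rewrite /= lg lf.
by split=> [|x y] /=; [rewrite g1 f1|rewrite gM fM].
Qed.

Lemma alg_hom_id (K : pzRingType) (A : pzAlgType K) : alg_hom (@id A).
Proof. by []. Qed.

(** The morphism [s] is kept general because equivariance compares derivations along a group element
    acting on the coordinate ring, and the moment map property compares derivations along the
    comorphism of X(Phi). *)
Definition derivation_along (K : pzRingType) (A B : pzAlgType K) (s D : A -> B) :=
  linear D /\ forall f g, D (f * g) = D f * s g + s f * D g.

Section DerivationAlong.
Variables (K : pzRingType) (A B : comPzAlgType K) (s : A -> B).
Hypothesis hs : alg_hom s.

Lemma derivation_along1 (D : A -> B) : derivation_along s D -> D 1 = 0.
Proof.
move=> [_ DM]; have := DM 1 1; have [_ [-> _]] := hs.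
by rewrite !mulr1 mul1r => /eqP; rewrite -subr_eq0 opprD addNKr oppr_eq0 => /eqP.
Qed.

Lemma derivation_along_add (D D' : A -> B) :
  derivation_along s D -> derivation_along s D' ->
  derivation_along s (fun f => D f + D' f).
Proof.
move=> [lD DM] [lD' DM']; split; first exact: linear_add.
by move=> f g; rewrite DM DM' mulrDl mulrDr addrACA.
Qed.

Lemma derivation_along_mull (b : B) (D : A -> B) :
  derivation_along s D -> derivation_along s (fun f => b * D f).
Proof.
move=> [lD DM]; split=> [k f g|f g]; first by rewrite lD mulrDr pzscalerAr.
by rewrite DM mulrDr mulrA (mulrCA b).
Qed.

Lemma derivation_along_mulr (b : B) (D : A -> B) :
  derivation_along s D -> derivation_along s (fun f => D f * b).
Proof.
move=> [lD DM]; split=> [k f g|f g]; first by rewrite lD mulrDl pzscalerAl.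
by rewrite DM mulrDl mulrA (mulrAC _ (s g)).
Qed.

Lemma derivation_along_opp (D : A -> B) :
  derivation_along s D -> derivation_along s (fun f => - D f).
Proof.
move=> [lD DM]; split=> [k f g|f g]; first by rewrite lD opprD scalerN.
by rewrite DM opprD mulNr mulrN.
Qed.

Lemma derivation_along_scale (k : K) (D : A -> B) :
  derivation_along s D -> derivation_along s (fun f => k *: D f).
Proof.
move=> hD; have [lD DM] := derivation_along_mull (k *: (1 : B)) hD.
have E : (fun f => k *: (1 : B) * D f) = (fun f => k *: D f).
  by apply/funext => f; rewrite -pzscalerAl mul1r.
by rewrite -E.
Qed.

Lemma derivation_along0 : derivation_along s (fun=> 0).
Proof. by split=> [k f g|f g]; rewrite ?scaler0 ?mul0r ?mulr0 addr0. Qed.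

Lemma derivation_along_sum (I : Type) (r : seq I) (D : I -> A -> B) :
  (forall i, derivation_along s (D i)) ->
  derivation_along s (fun f => \sum_(i <- r) D i f).
Proof.
move=> hD; elim: r => [|i r IH].
  have -> : (fun f => \sum_(i <- [::]) D i f) = (fun=> 0).
    by apply/funext => f; rewrite big_nil.
  exact: derivation_along0.
have -> : (fun f => \sum_(j <- i :: r) D j f)
    = (fun f => D i f + \sum_(j <- r) D j f).
  by apply/funext => f; rewrite big_cons.
exact: derivation_along_add.
Qed.
End DerivationAlong.

Lemma derivation_along_comp (K : pzRingType) (A B C : pzAlgType K)
    (s : B -> C) (g : A -> B) (D : B -> C) :
  alg_hom g -> derivation_along s D -> derivation_along (s \o g) (D \o g).
Proof.
move=> [lg [_ gM]] [lD DM].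
by split=> [k f h|f h] /=; rewrite ?lg ?lD ?gM ?DM.
Qed.

Lemma derivation_along_post (K : pzRingType) (A B C : pzAlgType K)
    (s : A -> B) (g : B -> C) (D : A -> B) :
  alg_hom g -> derivation_along s D -> derivation_along (g \o s) (g \o D).
Proof.
move=> [lg [_ gM]] [lD DM].
split=> [k f h|f h] /=; first by rewrite lD lg.
by rewrite DM (linear_funD lg) !gM.
Qed.

Section PresentedMaps.
Variables (K : pzRingType) (X : Type) (rel : pterm K X -> pterm K X -> Prop).
Variable C : comPzAlgType K.
Local Notation P := (presented rel).

Lemma alg_hom_ext (f g : P -> C) : alg_hom f -> alg_hom g ->
  (forall x, f (gen rel x) = g (gen rel x)) -> f =1 g.
Proof.
move=> [lf [f1 fM]] [lg [g1 gM]] fg; apply: pres_ind => //.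
- by rewrite f1 g1.
- by move=> k x y fx fy; rewrite lf lg fx fy.
- by move=> x y fx fy; rewrite fM gM fx fy.
Qed.

Lemma derivation_along_ext (s D D' : P -> C) : alg_hom s ->
  derivation_along s D -> derivation_along s D' ->
  (forall x, D (gen rel x) = D' (gen rel x)) -> D =1 D'.
Proof.
move=> hs hD hD' DD'; have D1 := derivation_along1 hs hD.
have D'1 := derivation_along1 hs hD'.
have [[lD DM] [lD' DM']] := (hD, hD').
apply: pres_ind => //; first by rewrite D1 D'1.
- by move=> k x y Dx Dy; rewrite lD lD' Dx Dy.
- by move=> x y Dx Dy; rewrite DM DM' Dx Dy.
Qed.

Lemma peval_gen (s : P -> C) (t : pterm K X) : alg_hom s ->
  peval (fun x => s (gen rel x)) t = s (pclass rel t).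
Proof.
move=> [ls [s1 sM]]; elim: t => //=.
- move=> k; rewrite -s1 -(linear_funZ ls); congr s.
  by rewrite [LHS]pclassZ; apply/pclassE/pc_sym/(pc_trans (pc_sym (pc_mul1 _ _)))/pc_mulC.
- by move=> t -> t' ->; rewrite -pclassD (linear_funD ls).
- by move=> t -> t' ->; rewrite -pclassM sM.
Qed.

Lemma peval_dual1 (v w : X -> C) (t : pterm K X) :
  (peval (S := dual C) (fun x => (v x, w x) : dual C) t).1 = peval v t.
Proof. by elim: t => //= t <- t' <-. Qed.

(* The lift along [gen x |-> s (gen x) + w x eps] to the dual numbers is       *)
(* [s + D eps], where [D] is the derivation along [s] with [D (gen x) = w x].   *)
Lemma dual_lift (s : P -> C) (w : X -> C) : alg_hom s ->
  let W x : dual C := (s (gen rel x), w x) in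
  (forall t t', rel t t' ->
     eps_coef (peval (S := dual C) W t) = eps_coef (peval (S := dual C) W t')) ->
  let D f := eps_coef (plift (S := dual C) W f) in
  derivation_along s D /\ forall x, D (gen rel x) = w x.
Proof.
move=> hs W hW D.
have hrel t t' : rel t t' -> peval (S := dual C) W t = peval (S := dual C) W t'.
  move=> tt'; rewrite [LHS]surjective_pairing [RHS]surjective_pairing.
  congr (_, _); last exact: hW.
  rewrite !peval_dual1 !(peval_gen _ hs); congr s.
  exact/pclassE/pc_rel.
have [lL [L1 LM]] := plift_alg_hom hrel.
(* The constant term of the lift is itself an algebra morphism agreeing with [s] on generators; this
   turns multiplicativity of the lift into the Leibniz rule along [s]. *)
have Ls (f : P) : (plift (S := dual C) W f).1 = s f.
  have hL : alg_hom (fun f : P => (plift (S := dual C) W f).1 : C).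
    split=> [k x y|]; first exact: (congr1 fst (lL k x y)).
    by split=> [|x y]; [exact: (congr1 fst L1)|exact: (congr1 fst (LM x y))].
  by apply: (alg_hom_ext hL hs) => x /=; rewrite (plift_gen x hrel).
split; last by move=> x; rewrite /D (plift_gen x hrel).
split=> [k f g|f g]; first exact: (congr1 snd (lL k f g)).
by rewrite addrC -!Ls; exact: (congr1 snd (LM f g)).
Qed.
End PresentedMaps.

(** * Tensor operations and coordinates *)

Lemma linear_comp (K : pzRingType) (U V W : lmodType K) (f : V -> W) (g : U -> V) :
  linear f -> linear g -> linear (fun x => f (g x)).
Proof. by move=> lf lg k x y; rewrite lg lf. Qed.

Lemma linear_mull (K : pzRingType) (U : lmodType K) (B : pzAlgType K)
    (b : B) (f : U -> B) : linear f -> linear (fun x => b * f x).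
Proof. by move=> lf k x y; rewrite lf mulrDr pzscalerAr. Qed.

Lemma linear_mulr (K : pzRingType) (U : lmodType K) (B : pzAlgType K)
    (b : B) (f : U -> B) : linear f -> linear (fun x => f x * b).
Proof. by move=> lf k x y; rewrite lf mulrDl pzscalerAl. Qed.

Lemma tensor_ext (K : pzRingType) (U V W : lmodType K) (f g : tensor U V -> W) :
  linear f -> linear g -> (forall u v, f (u \ox v) = g (u \ox v)) -> f =1 g.
Proof.
move=> lf lg fg; apply: tensor_ind => // k x y fx fy.
by rewrite lf lg fx fy.
Qed.

Lemma bilin_pure (K : pzRingType) (U V U' V' : lmodType K)
    (f : U -> U') (g : V -> V') :
  linear f -> linear g -> bilin (fun u v => f u \ox g v).
Proof.
move=> lf lg; have [pl pr] := @pure_bilin K U' V'.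
by split=> [v|u] k x y; rewrite ?lf ?lg ?pl ?pr.
Qed.

Lemma bilin_swap (K : pzRingType) (U V W : lmodType K) (f : U -> V -> W) :
  bilin f -> bilin (fun v u => f u v).
Proof. by case. Qed.

Section TensorOperations.
Variables (K : fieldType) (A : pzAlgType K).
Local Notation T2 := (tensor A A).
Local Notation T3 := (tensor (tensor A A) A).

Lemma linear_idfun (V : lmodType K) : linear (@id V). Proof. by []. Qed.

Lemma tswap_bilin : bilin (fun d1 d2 : A => d2 \ox d1).
Proof. exact/bilin_swap/pure_bilin. Qed.
Lemma tswap_pure (a b : A) : tswap (a \ox b) = b \ox a.
Proof. exact: tlift_pure tswap_bilin. Qed.
Lemma tswap_linear : linear (@tswap K A).
Proof. exact: tlift_linear tswap_bilin. Qed.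

Lemma outer_bilin (a b : A) : bilin (fun d1 d2 : A => (a * d1) \ox (d2 * b)).
Proof.
by apply: bilin_pure; [apply: linear_mull|apply: linear_mulr]; apply: linear_idfun.
Qed.
Lemma outer_pure (a b c d : A) : outer a (c \ox d) b = (a * c) \ox (d * b).
Proof. exact: (tlift_pure _ _ (outer_bilin _ _)). Qed.
Lemma outer_linear (a b : A) : linear (fun d => outer a d b).
Proof. exact: tlift_linear (outer_bilin _ _). Qed.

Lemma inner_bilin (a b : A) : bilin (fun d1 d2 : A => (d1 * b) \ox (a * d2)).
Proof.
by apply: bilin_pure; [apply: linear_mulr|apply: linear_mull]; apply: linear_idfun.
Qed.
Lemma inner_pure (a b c d : A) : inner a (c \ox d) b = (c * b) \ox (a * d).
Proof. exact: (tlift_pure _ _ (inner_bilin _ _)). Qed.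
Lemma inner_linear (a b : A) : linear (fun d => inner a d b).
Proof. exact: tlift_linear (inner_bilin _ _). Qed.

Lemma tmap2_pure (f : A -> A) (a b : A) :
  linear f -> tmap2 f (a \ox b) = f a \ox f b.
Proof. by move=> lf; apply: tlift_pure (bilin_pure lf lf). Qed.
Lemma tmap2_linear (f : A -> A) : linear f -> linear (tmap2 f).
Proof. by move=> lf; apply: tlift_linear (bilin_pure lf lf). Qed.

Lemma rot3_bilin (a3 : A) : bilin (fun a1 a2 : A => a3 \ox a1 \ox a2).
Proof.
have [pl pr] := @pure_bilin K A A; have [ql qr] := @pure_bilin K T2 A.
by split=> [v|u] k x y; rewrite ?pr ?ql ?qr.
Qed.
Lemma tau123_bilin : bilin (fun (d : T2) (a3 : A) =>
  tlift (fun a1 a2 : A => a3 \ox a1 \ox a2) d).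
Proof.
split=> [a3|d]; first exact: tlift_linear (rot3_bilin _).
have [pl pr] := @pure_bilin K A A; have [ql qr] := @pure_bilin K T2 A.
move=> k a b; move: d; apply: tensor_ext => [||a1 a2].
- exact: tlift_linear (rot3_bilin _).
- apply: linear_add; last exact: tlift_linear (rot3_bilin _).
  by apply: linear_scaler; exact: tlift_linear (rot3_bilin _).
- by rewrite !(tlift_pure _ _ (rot3_bilin _)) pl ql.
Qed.
Lemma tau123_pure (a b c : A) : tau123 (a \ox b \ox c) = c \ox a \ox b.
Proof.
by rewrite /tau123 (tlift_pure _ _ tau123_bilin) (tlift_pure _ _ (rot3_bilin _)).
Qed.
Lemma tau123_linear : linear (@tau123 K A).
Proof. exact: tlift_linear tau123_bilin. Qed.

Lemma tensor3_ext (W : lmodType K) (f g : T3 -> W) : linear f -> linear g ->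
  (forall a b c, f (a \ox b \ox c) = g (a \ox b \ox c)) -> f =1 g.
Proof.
move=> lf lg fg; have [pl _] := @pure_bilin K T2 A.
apply: tensor_ext => // d c; move: d.
apply: tensor_ext => // k x y; first by rewrite pl lf.
by rewrite pl lg.
Qed.

Section Dbr.
Variable dbr : A -> A -> T2.
Hypothesis bdbr : bilin dbr.

Lemma dbrL_bilin (a : A) : bilin (fun d1 d2 : A => dbr a d1 \ox d2).
Proof.
have [_ br] := bdbr; exact: bilin_pure (br a) (@linear_idfun _).
Qed.
Lemma dbrL_pure (a b c : A) : dbrL dbr a (b \ox c) = dbr a b \ox c.
Proof. exact: (tlift_pure _ _ (dbrL_bilin _)). Qed.
Lemma dbrL_linear (a : A) : linear (dbrL dbr a).
Proof. exact: tlift_linear (dbrL_bilin _). Qed.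
End Dbr.
End TensorOperations.

Section Coordinates.
Variables (K : fieldType) (A : pzAlgType K) (B : comPzAlgType K) (N : nat).
Variable x : A -> 'I_N -> 'I_N -> B.
Hypothesis lx : forall i j, linear (fun a => x a i j).
Hypothesis xM : forall a b i j, x (a * b) i j = \sum_r x a i r * x b r j.
Local Notation T2 := (tensor A A).
Local Notation T3 := (tensor (tensor A A) A).

(* [ev2 k j i l d] is the coordinate written d_{kj,il} in the paper, and        *)
(* [ev3] its analogue for three factors.                                       *)
Definition ev2 (k j i l : 'I_N) (d : T2) : B :=
  tlift (fun a b : A => x a k j * x b i l) d.
Definition ev3 (p q r s t w : 'I_N) (d : T3) : B :=
  tlift (fun (d : T2) (c : A) => ev2 p q r s d * x c t w) d.

Lemma ev2_bilin k j i l : bilin (fun a b : A => x a k j * x b i l).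
Proof. by split=> [b|a]; [apply: linear_mulr|apply: linear_mull]; apply: lx. Qed.
Lemma ev2_linear k j i l : linear (ev2 k j i l).
Proof. exact: tlift_linear (ev2_bilin _ _ _ _). Qed.
Lemma ev2_pure k j i l a b : ev2 k j i l (a \ox b) = x a k j * x b i l.
Proof. exact: (tlift_pure _ _ (ev2_bilin _ _ _ _)). Qed.

Lemma ev3_bilin p q r s t w :
  bilin (fun (d : T2) (c : A) => ev2 p q r s d * x c t w).
Proof.
by split=> [c|d]; [apply: linear_mulr; apply: ev2_linear|apply: linear_mull].
Qed.
Lemma ev3_linear p q r s t w : linear (ev3 p q r s t w).
Proof. exact: tlift_linear (ev3_bilin _ _ _ _ _ _). Qed.
Lemma ev3_pure2 p q r s t w d c :
  ev3 p q r s t w (d \ox c) = ev2 p q r s d * x c t w.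
Proof. exact: (tlift_pure _ _ (ev3_bilin _ _ _ _ _ _)). Qed.
Lemma ev3_pure p q r s t w a b c :
  ev3 p q r s t w (a \ox b \ox c) = x a p q * x b r s * x c t w.
Proof. by rewrite ev3_pure2 ev2_pure. Qed.

Lemma ev2_swap k j i l d : ev2 k j i l (tswap d) = ev2 i l k j d.
Proof.
move: d; apply: tensor_ext => [||a b].
- exact: linear_comp (ev2_linear _ _ _ _) (@tswap_linear _ _).
- exact: ev2_linear.
- by rewrite tswap_pure !ev2_pure mulrC.
Qed.

Lemma ev2_outer1l k j i l d c :
  ev2 k j i l (outer 1 d c) = \sum_r ev2 k j i r d * x c r l.
Proof.
move: d; apply: tensor_ext => [||a b].
- exact: linear_comp (ev2_linear _ _ _ _) (outer_linear _ _).
- by apply: linear_sum => r; apply: linear_mulr; apply: ev2_linear.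
- rewrite outer_pure mul1r ev2_pure xM mulr_sumr.
  by apply: eq_bigr => r _; rewrite ev2_pure mulrA.
Qed.
Lemma ev2_outer1r k j i l d b :
  ev2 k j i l (outer b d 1) = \sum_r x b k r * ev2 r j i l d.
Proof.
move: d; apply: tensor_ext => [||a c].
- exact: linear_comp (ev2_linear _ _ _ _) (outer_linear _ _).
- by apply: linear_sum => r; apply: linear_mull; apply: ev2_linear.
- rewrite outer_pure mulr1 ev2_pure xM mulr_suml.
  by apply: eq_bigr => r _; rewrite ev2_pure mulrA.
Qed.
Lemma ev2_inner1l k j i l d c :
  ev2 k j i l (inner 1 d c) = \sum_r ev2 k r i l d * x c r j.
Proof.
move: d; apply: tensor_ext => [||a b].
- exact: linear_comp (ev2_linear _ _ _ _) (inner_linear _ _).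
- by apply: linear_sum => r; apply: linear_mulr; apply: ev2_linear.
- rewrite inner_pure mul1r ev2_pure xM mulr_suml.
  by apply: eq_bigr => r _; rewrite ev2_pure mulrAC.
Qed.
Lemma ev2_inner1r k j i l d b :
  ev2 k j i l (inner b d 1) = \sum_r x b i r * ev2 k j r l d.
Proof.
move: d; apply: tensor_ext => [||a c].
- exact: linear_comp (ev2_linear _ _ _ _) (inner_linear _ _).
- by apply: linear_sum => r; apply: linear_mull; apply: ev2_linear.
- rewrite inner_pure mulr1 ev2_pure xM mulr_sumr.
  by apply: eq_bigr => r _; rewrite ev2_pure mulrCA.
Qed.

Lemma ev3_tau p q r s t w d : ev3 p q r s t w (tau123 d) = ev3 r s t w p q d.
Proof.
move: d; apply: tensor3_ext => [||a b c].
- exact: linear_comp (ev3_linear _ _ _ _ _ _) (@tau123_linear _ _).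
- exact: ev3_linear.
- by rewrite tau123_pure !ev3_pure; ring.
Qed.

Section Anti.
Variable phi : A -> A.
Hypothesis lphi : linear phi.
Hypothesis xphi : forall a i j, x (phi a) i j = x a j i.

Lemma ev2_tmap2 k j i l d : ev2 k j i l (tmap2 phi d) = ev2 j k l i d.
Proof.
move: d; apply: tensor_ext => [||a b].
- exact: linear_comp (ev2_linear _ _ _ _) (tmap2_linear lphi).
- exact: ev2_linear.
- by rewrite tmap2_pure // !ev2_pure !xphi.
Qed.
End Anti.
End Coordinates.

(** * Trace identities *)

Section MatrixUnits.
Variables (B : comPzRingType) (N : nat).
Implicit Types (P Q R M : 'M[B]_N).

Lemma mul_mx_deltaE P Q i j p q : (P *m delta_mx j i *m Q) p q = P p j * Q i q.
Proof.
rewrite !mxE (bigD1 i) //= big1 ?addr0 => [|r ri].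
  rewrite !mxE (bigD1 j) //= big1 ?addr0 => [|s sj].
    by rewrite !mxE !eqxx mulr1.
  by rewrite !mxE (negPf sj) mulr0.
rewrite !mxE big1 ?mul0r // => s _.
by rewrite !mxE (negPf ri) andbF mulr0.
Qed.

Lemma orthogonal_mulmx P Q :
  P^T *m P = 1%:M -> Q^T *m Q = 1%:M -> (P *m Q)^T *m (P *m Q) = 1%:M.
Proof. by move=> hP hQ; rewrite trmx_mul mulmxA -(mulmxA Q^T) hP mulmx1. Qed.

Lemma trmx_delta i j : (delta_mx i j : 'M[B]_N)^T = delta_mx j i.
Proof. by apply/matrixP => p q; rewrite !mxE andbC. Qed.

Lemma mxtrace_delta P i j : \tr (P *m delta_mx j i) = P i j.
Proof.
rewrite /mxtrace (bigD1 i) //= big1 ?addr0 => [|r ri].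
  by rewrite -[_ *m _]mulmx1 mul_mx_deltaE !mxE eqxx mulr1.
by rewrite -[_ *m _]mulmx1 mul_mx_deltaE !mxE eq_sym (negPf ri) mulr0.
Qed.

Lemma mxtrace_delta3 P0 P1 Q R i j k l u v :
  \tr (P0 *m delta_mx j i *m Q *m delta_mx l k *m R *m delta_mx v u *m P1)
  = (P1 *m P0) u j * Q i l * R k v.
Proof.
by rewrite mxtrace_mulC !mulmxA mxtrace_delta !mul_mx_deltaE.
Qed.

(* The matrix [M] with [\tr (xi *m M)] equal to [[X(a), xi]_ij], the            *)
(* infinitesimal action of [xi] on [a_ij].                                     *)
Definition grad_mx M (i j : 'I_N) : 'M[B]_N :=
  delta_mx j i *m M - M *m delta_mx j i.

Lemma mxtrace_grad P M i j :
  \tr (P *m grad_mx M i j) = (M *m P - P *m M) i j.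
Proof.
rewrite /grad_mx mulmxBr raddfB /= mulmxA mxtrace_mulC !mulmxA !mxtrace_delta.
by rewrite !mxE.
Qed.

Lemma mul_mx_gradE P Q M k l p q : (P *m grad_mx M k l *m Q) p q
  = P p l * (M *m Q) k q - (P *m M) p l * Q k q.
Proof.
rewrite /grad_mx mulmxBr mulmxBl !mulmxA -(mulmxA _ M Q).
rewrite [LHS]mxE [X in _ + X]mxE.
by rewrite !mul_mx_deltaE.
Qed.

Lemma grad_mx_tr M i j : grad_mx M^T j i = - (grad_mx M i j)^T.
Proof. by rewrite /grad_mx [in RHS]raddfB /= !trmx_mul !trmx_delta opprB. Qed.

(** Each commutator contributes two terms, and each of the eight resulting traces of words
    containing three matrix units splits into a product of three entries. The order and signs on the
    right are those of the quasi-Poisson condition. *)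
Lemma mxtrace_grad3 E M1 M2 M3 i j k l u v :
  \tr (E *m grad_mx M1 i j *m E *m grad_mx M2 k l *m E *m grad_mx M3 u v)
  = (M3 *m E *m M1) u j * (E *m M2) i l * E k v
  - (M3 *m E *m M1) u j * E i l * (M2 *m E) k v
  - (M3 *m E) u j * (M1 *m E *m M2) i l * E k v
  + (M3 *m E) u j * (M1 *m E) i l * (M2 *m E) k v
  - (E *m M1) u j * (E *m M2) i l * (E *m M3) k v
  + (E *m M1) u j * E i l * (M2 *m E *m M3) k v
  + E u j * (M1 *m E *m M2) i l * (E *m M3) k v
  - E u j * (M1 *m E) i l * (M2 *m E *m M3) k v.
Proof.
have t0 P0 Q R : (P0 : 'M[B]_N) u j * Q i l * R k v
  = \tr (P0 *m delta_mx j i *m Q *m delta_mx l k *m R *m delta_mx v u).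
  by have := mxtrace_delta3 P0 1%:M Q R i j k l u v; rewrite mul1mx mulmx1 => ->.
rewrite -!(mulmxA M3) -!(mxtrace_delta3 _ M3) !t0 /grad_mx.
rewrite !(mulmxBl, mulmxBr) ?mulmxA ?(mulmxBl, mulmxBr) ?mulmxA.
rewrite !raddfB /=.
(* Both sides are now combinations of the same eight traces, so these can be treated as unknowns. *)
do 8! [move: (\tr _) => ?].
ring.
Qed.

(** Transposing under the trace reverses a word, and the signs from the two antisymmetric factors
    cancel. The two terms containing M^T thus duplicate the two containing M. *)
Lemma mxtrace_asym P Q M : P^T = - P -> Q^T = - Q ->
  \tr (P *m (Q *m (M - M^T) - (M - M^T) *m Q))
  = (\tr (P *m Q *m M) - \tr (P *m M *m Q)) *+ 2.
Proof.
move=> hP hQ; rewrite !(mulmxBl, mulmxBr) !raddfB /= !mulmxA.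
have -> : \tr (P *m Q *m M^T) = \tr (P *m M *m Q).
  by rewrite -mxtrace_tr !trmx_mul trmxK hP hQ !(mulmxN, mulNmx) opprK mulmxA
    mxtrace_mulC mulmxA.
have -> : \tr (P *m M^T *m Q) = \tr (P *m Q *m M).
  by rewrite -mxtrace_tr !trmx_mul trmxK hP hQ !(mulmxN, mulNmx) opprK mulmxA
    mxtrace_mulC mulmxA.
ring.
Qed.

(** Antisymmetrizing W only doubles the trace once the other two factors are antisymmetric, so a sum
    over the four twists of U and V suffices to antisymmetrize all three. *)
Lemma mxtrace_asym3 U V W
    (T := fun P Q R : 'M[B]_N => \tr (P *m Q *m R) - \tr (P *m R *m Q)) :
  \tr ((U - U^T) *m ((V - V^T) *m (W - W^T) - (W - W^T) *m (V - V^T)))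
  = (T U V W + T (- U^T) V W + T U (- V^T) W + T (- U^T) (- V^T) W) *+ 2.
Proof.
have asym (Z : 'M[B]_N) : (Z - Z^T)^T = - (Z - Z^T).
  by rewrite raddfB /= trmxK opprB.
rewrite (mxtrace_asym W (asym U) (asym V)) /T; congr (_ *+ 2).
rewrite !(mulmxDl, mulmxDr) !raddfD /=.
do 8! [move: (\tr _) => ?].
ring.
Qed.
End MatrixUnits.

Section BlockPart.
Variables (B : comPzRingType) (N n : nat) (E : 'I_n -> 'M[B]_N).
Hypothesis Eidem : forall s t, E s *m E t = if s == t then E s else 0.

Definition block_part (M : 'M[B]_N) : 'M[B]_N := \sum_s E s *m M *m E s.

Lemma block_partN M : block_part (- M) = - block_part M.
Proof.
by rewrite -sumrN; apply: eq_bigr => s _; rewrite mulmxN mulNmx.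
Qed.

Lemma block_part_tr M : (forall s, (E s)^T = E s) ->
  block_part M^T = (block_part M)^T.
Proof.
move=> Et; rewrite (raddf_sum (@trmx B N N)); apply: eq_bigr => s _ /=.
by rewrite !trmx_mul Et mulmxA.
Qed.

Lemma mulmx_block_part (F : 'I_n -> 'M[B]_N) M :
  (\sum_s F s *m E s) *m block_part M = \sum_s F s *m E s *m M *m E s.
Proof.
rewrite mulmx_suml; apply: eq_bigr => s _.
rewrite mulmx_sumr (bigD1 s) //= big1 ?addr0 => [|t ts].
  by rewrite !mulmxA -(mulmxA (F s)) Eidem eqxx.
by rewrite !mulmxA -(mulmxA (F s)) Eidem eq_sym (negPf ts) mulmx0 !mul0mx.
Qed.

Lemma mxtrace_block_part3 M1 M2 M3 :
  \tr (block_part M1 *m block_part M2 *m block_part M3)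
  = \sum_s \tr (E s *m M1 *m E s *m M2 *m E s *m M3).
Proof.
rewrite {1}/block_part mulmx_block_part mulmx_block_part raddf_sum.
apply: eq_bigr => s _ /=; rewrite [LHS]mxtrace_mulC !mulmxA.
by rewrite Eidem eqxx.
Qed.

Definition asym_part M := block_part M - (block_part M)^T.

End BlockPart.

(** * The Jacobiator on generators *)

Lemma double_antisym_phi (K : fieldType) (A : pzAlgType K) (n : nat)
    (e : 'I_n -> A) (dbr : A -> A -> tensor A A) (phi : A -> A) (a b : A) :
  compatible_involution e dbr phi ->
  dbr (phi a) (phi b) = tswap (tmap2 phi (dbr a b)).
Proof.
move=> [lphi _ _ _ ->]; move: (dbr _ _); apply: tensor_ext => // [|u v].
  exact: linear_comp (@tswap_linear _ _) (@tswap_linear _ _).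
by rewrite !tswap_pure.
Qed.

Lemma sum_four_cyclic (K : comPzRingType) (B : comPzAlgType K) (k : K)
    (p1 p2 p3 p4 q1 q2 q3 q4 r1 r2 r3 r4 j1 j2 j3 j4 : B) :
  p1 + q1 + r1 = k *: j1 -> p2 + q2 + r2 = k *: j2 ->
  p3 + q3 + r3 = k *: j3 -> p4 + q4 + r4 = k *: j4 ->
  k *: (p1 + p2 + p3 + p4) + k *: (q1 + q3 + q4 + q2) + k *: (r1 + r4 + r2 + r3)
  = (k * k) *: (j1 + j2 + j3 + j4).
Proof.
move=> h1 h2 h3 h4; rewrite -scalerA -!scalerDr; congr (_ *: _).
by rewrite !scalerDr -h1 -h2 -h3 -h4; ring.
Qed.

Section Jacobi.
Variables (K : fieldType) (A : pzAlgType K) (B : comPzAlgType K) (n N : nat).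
Variables (e : 'I_n -> A) (dbr : A -> A -> tensor A A) (phi : A -> A).
Variable x : A -> 'I_N -> 'I_N -> B.
Hypothesis he : idempotent_decomposition e.
Hypothesis hdbr : double_quasi_poisson e dbr.
Hypothesis hphi : compatible_involution e dbr phi.
Hypothesis lx : forall i j, linear (fun a => x a i j).
Hypothesis xM : forall a b i j, x (a * b) i j = \sum_r x a i r * x b r j.
Hypothesis xphi : forall a i j, x (phi a) i j = x a j i.
Variable br : B -> B -> B.
Hypothesis hbr : antisym_biderivation br.
Hypothesis brE : forall a b i j k l, br (x a i j) (x b k l)
  = 2%:R^-1 *: ev2 x k j i l (dbr a b) + 2%:R^-1 *: ev2 x k i j l (dbr (phi a) b).

Local Notation X a := (\matrix_(i, j) x a i j).
Local Notation M a i j := (grad_mx (X a) i j).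
Local Notation E := (fun s => X (e s)).
Local Notation bl := (block_part E).

Let bdbr : bilin dbr. Proof. by case: hdbr => -[]. Qed.
Let lphi : linear phi. Proof. by case: hphi. Qed.
Let phiK : involutive phi. Proof. by case: hphi. Qed.

Lemma mx_mulE a b : X (a * b) = X a *m X b.
Proof.
by apply/matrixP => i j; rewrite !mxE xM; apply: eq_bigr => r _; rewrite !mxE.
Qed.

Lemma mx_phiE a : X (phi a) = (X a)^T.
Proof. by apply/matrixP => i j; rewrite !mxE xphi. Qed.

Lemma mx_idem s t : E s *m E t = if s == t then E s else 0.
Proof.
have [ee _] := he; rewrite -mx_mulE ee; case: eqP => // _.
by apply/matrixP => i j; rewrite !mxE (linear_fun0 (@lx i j)).
Qed.

Lemma mx_idem_tr s : (E s)^T = E s.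
Proof. by have [_ _ _ phie _] := hphi; rewrite -mx_phiE phie. Qed.

Lemma grad_phi a i j : M (phi a) j i = - (M a i j)^T.
Proof. by rewrite mx_phiE grad_mx_tr. Qed.

(** For each s, the eight terms of the quasi-Poisson condition evaluate to the eight products of
    [mxtrace_grad3] with E = X(e_s). Orthogonality of the idempotents reassembles the sum over s
    into block parts. *)
Lemma ev3_triple a b c i j k l u v :
  ev3 x u j i l k v (triple_bracket dbr a b c)
  = 4%:R^-1 *: \tr (bl (M a i j) *m bl (M b k l) *m bl (M c u v)).
Proof.
have [_ ->] := hdbr; have le := @ev3_linear _ _ _ _ _ lx u j i l k v.
rewrite (linear_funZ le) (linear_fun_sum le) (mxtrace_block_part3 mx_idem).
congr (_ *: _); apply: eq_bigr => s _.
rewrite mxtrace_grad3 -!mx_mulE.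
rewrite !(linear_funB le, linear_funD le) !(ev3_pure lx) !mxE.
by [].
Qed.

Lemma ev3_dbrL_linear p q r s t w a :
  linear (fun d => ev3 x p q r s t w (dbrL dbr a d)).
Proof. exact: linear_comp (ev3_linear lx _ _ _ _ _ _) (dbrL_linear bdbr _). Qed.

(** Writing b as phi(phi(b)) lets compatibility apply to the inner double bracket; the twist thereby
    moves from [a] to the tensor [d], at the price of permuting the indices. *)
Lemma ev3_dbrL_phi a d k p q j i l :
  ev3 x k p q j i l (dbrL dbr (phi a) d)
  = ev3 x j q p k l i (dbrL dbr a (tmap2 phi d)).
Proof.
move: d; apply: tensor_ext => [||b c].
- exact: ev3_dbrL_linear.
- exact: linear_comp (ev3_dbrL_linear _ _ _ _ _ _ _) (tmap2_linear lphi).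
- rewrite tmap2_pure // !dbrL_pure // !ev3_pure2 // xphi; congr (_ * _).
  rewrite -[in LHS](phiK b) (double_antisym_phi _ _ hphi) ev2_swap //.
  exact: ev2_tmap2.
Qed.

(* The bracket of [a_pq] with [d_{kj,il}] before symmetrization by [phi].       *)
Let Q a p q k j i l d := ev3 x k q p j i l (dbrL dbr a d)
  + ev3 x i q p l k j (dbrL dbr a (tswap d)).

Lemma br_ev2 a p q k j i l d : br (x a p q) (ev2 x k j i l d)
  = 2%:R^-1 *: (Q a p q k j i l d + Q (phi a) q p k j i l d).
Proof.
have [[_ lbr] _ brM _] := hbr.
have lQ a' p' q' : linear (Q a' p' q' k j i l).
  apply: linear_add; first exact: ev3_dbrL_linear.
  exact: linear_comp (ev3_dbrL_linear _ _ _ _ _ _ _) (@tswap_linear _ _).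
move: d; apply: tensor_ext => [||b c].
- exact: linear_comp (lbr _) (ev2_linear lx _ _ _ _).
- by apply: linear_scaler; apply: linear_add; apply: lQ.
- rewrite ev2_pure // brM !brE /Q tswap_pure !dbrL_pure // !ev3_pure2 //.
  rewrite !mulrDl !mulrDr -!pzscalerAl -!pzscalerAr -!scalerDr.
  by congr (_ *: _); ring.
Qed.

(** The untwisted part of the bracket of a_ij with that of b_kl and c_uv. The minus sign arises from
    replacing the swap of the double bracket of b and c by minus that of c and b. *)
Let Q3 a i j b k l c u v := ev3 x u j i l k v (dbrL dbr a (dbr b c))
  - ev3 x k j i v u l (dbrL dbr a (dbr c b)).

Lemma br_br a i j b k l c u v : br (x a i j) (br (x b k l) (x c u v))
  = 4%:R^-1 *: (Q3 a i j b k l c u v + Q3 (phi a) j i b k l c u v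
      + Q3 a i j (phi b) l k c u v + Q3 (phi a) j i (phi b) l k c u v).
Proof.
have [[_ lbr] _ _ _] := hbr; have [[_ anti _ _ _] _] := hdbr.
have QE a' i' j' b' k' l' : Q a' i' j' u l' k' v (dbr b' c)
    = Q3 a' i' j' b' k' l' c u v.
  by rewrite /Q /Q3 (anti c b') (linear_funN (ev3_dbrL_linear _ _ _ _ _ _ _)) opprK.
rewrite brE (linear_funD (lbr _)) !(linear_funZ (lbr _)) !br_ev2 !QE.
rewrite !scalerA -scalerDr -!addrA.
by rewrite -invfM -natrM.
Qed.

(** Twisting all three arguments makes the two summands of [Q3] trade places: [ev3_dbrL_phi] handles
    the outer bracket, and compatibility with antisymmetry handles the inner one. *)
Lemma Q3_phi a i j b k l c u v :
  Q3 (phi a) j i (phi b) l k (phi c) v u = Q3 a i j b k l c u v.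
Proof.
have [[_ anti _ _ _] _] := hdbr.
have tphi b' c' : tmap2 phi (dbr (phi b') (phi c')) = - dbr c' b'.
  by case: hphi => _ _ _ _ ->; rewrite !phiK (anti c' b') opprK.
have le p q r s t w d : ev3 x p q r s t w (dbrL dbr a (- d))
    = - ev3 x p q r s t w (dbrL dbr a d).
  exact: linear_funN (ev3_dbrL_linear _ _ _ _ _ _ _) _.
by rewrite /Q3 !ev3_dbrL_phi !tphi !le opprK addrC.
Qed.

Let J3 a i j b k l c u v :=
  \tr (bl (M a i j) *m bl (M b k l) *m bl (M c u v))
  - \tr (bl (M a i j) *m bl (M c u v) *m bl (M b k l)).

(** The first summands of the three rotated terms add up to a coordinate of the triple bracket of a,
    b, c, and the second summands to minus one of a, c, b; the rotations [tau123] match the index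
    shifts. *)
Lemma Q3_cyclic a i j b k l c u v :
  Q3 a i j b k l c u v + Q3 b k l c u v a i j + Q3 c u v a i j b k l
  = 4%:R^-1 *: J3 a i j b k l c u v.
Proof.
rewrite /J3 scalerBr -!ev3_triple /triple_bracket.
rewrite !(linear_funD (ev3_linear lx _ _ _ _ _ _)) !ev3_tau // /Q3.
ring.
Qed.

(** The three iterated brackets give twelve [Q3] terms. Since [Q3_phi] allows twists to be taken
    modulo the simultaneous one, every twist of c can be traded for twists of a and b; the twelve
    terms then form four cyclic sums. *)
Lemma jacobi_coord a i j b k l c u v :
  br (x a i j) (br (x b k l) (x c u v)) + br (x b k l) (br (x c u v) (x a i j))
  + br (x c u v) (br (x a i j) (x b k l))
  = 16%:R^-1 *: (J3 a i j b k l c u v + J3 (phi a) j i b k l c u v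
      + J3 a i j (phi b) l k c u v + J3 (phi a) j i (phi b) l k c u v).
Proof.
rewrite !br_br.
have Qp1 : Q3 (phi b) l k (phi c) v u a i j = Q3 b k l c u v (phi a) j i.
  by rewrite -Q3_phi !phiK.
have Qp2 : Q3 b k l (phi c) v u a i j = Q3 (phi b) l k c u v (phi a) j i.
  by rewrite -Q3_phi !phiK.
have Qp3 : Q3 (phi c) v u a i j b k l = Q3 c u v (phi a) j i (phi b) l k.
  by rewrite -Q3_phi !phiK.
have Qp4 : Q3 (phi c) v u (phi a) j i b k l = Q3 c u v a i j (phi b) l k.
  by rewrite -Q3_phi !phiK.
rewrite Qp1 Qp2 Qp3 Qp4.
have -> : 16%:R^-1 = 4%:R^-1 * 4%:R^-1 :> K by rewrite -invfM -natrM.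
exact: (sum_four_cyclic (Q3_cyclic a i j b k l c u v)
  (Q3_cyclic (phi a) j i b k l c u v) (Q3_cyclic a i j (phi b) l k c u v)
  (Q3_cyclic (phi a) j i (phi b) l k c u v)).
Qed.

Hypothesis two_neq0 : 2%:R != 0 :> K.

Lemma jacobi_asym a i j b k l c u v :
  br (x a i j) (br (x b k l) (x c u v)) + br (x b k l) (br (x c u v) (x a i j))
  + br (x c u v) (br (x a i j) (x b k l))
  = 32%:R^-1 *: \tr (asym_part E (M a i j) *m
      (asym_part E (M b k l) *m asym_part E (M c u v)
       - asym_part E (M c u v) *m asym_part E (M b k l))).
Proof.
rewrite jacobi_coord.
have E16 : 16%:R^-1 = 32%:R^-1 * 2%:R :> K.
  by rewrite -[32%N]/(16 * 2)%N natrM invfM mulfVK.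
rewrite E16 -scalerA scaler_nat; congr (_ *: _).
have blphi a' i' j' : bl (M (phi a') j' i') = - (bl (M a' i' j'))^T.
  by rewrite grad_phi block_partN (block_part_tr _ mx_idem_tr).
rewrite /J3 !blphi /asym_part.
exact/esym/mxtrace_asym3.
Qed.
End Jacobi.

(** * The Cartan trivector *)

Lemma wedge3E (K : fieldType) (B : comPzAlgType K) (N : nat)
    (inf : 'M[K]_N -> B -> B) (x1 x2 x3 : 'M[K]_N) (f g h : B) :
  wedge3 inf x1 x2 x3 f g h
  = inf x1 f * inf x2 g * inf x3 h - inf x1 f * inf x2 h * inf x3 g
  - inf x1 g * inf x2 f * inf x3 h + inf x1 g * inf x2 h * inf x3 f
  + inf x1 h * inf x2 f * inf x3 g - inf x1 h * inf x2 g * inf x3 f.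
Proof.
pose W : 'M[B]_3 :=
  \matrix_(r, k) inf (tnth [tuple x1; x2; x3] k) (tnth [tuple f; g; h] r).
(* The sum over permutations defining the wedge is a Leibniz determinant, so expanding along rows
   avoids enumerating the symmetric group. *)
have -> : wedge3 inf x1 x2 x3 f g h = \det W.
  apply: eq_bigr => s _; congr (_ * _); apply: eq_bigr => r _.
  by rewrite mxE.
rewrite (expand_det_row _ ord0) !big_ord_recl big_ord0 /cofactor.
rewrite !(expand_det_row _ ord0) !big_ord_recl !big_ord0 /cofactor !det_mx11.
rewrite !mxE /= /bump /= !(tnth_nth 0) /=.
ring.
Qed.

(** * The partition of the indices into blocks *)

Section Blocks.
Variables (n : nat) (alpha : 'I_n -> nat).
Local Notation N := (total_dim alpha).

Lemma in_block_inj (s t : 'I_n) (i : 'I_N) : in_block s i -> in_block t i -> s = t.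
Proof.
have lt_block (u v : 'I_n) : (u < v)%N -> in_block u i -> ~~ in_block v i.
  move=> uv /andP[_ iu]; rewrite /in_block negb_and -ltnNge.
  apply/orP; left; apply: leq_trans iu _.
  rewrite [leqRHS](bigID (fun t : 'I_n => (t <= u)%N)) /=.
  apply: leq_trans (leq_addr _ _).
  rewrite leq_eqVlt; apply/orP; left; apply/eqP; apply: eq_bigl => t'.
  by case: (leqP t' u) => tu; rewrite ?andbF // (leq_ltn_trans tu uv).
move=> si ti; apply/val_inj; case: (ltngtP s t) => // st.
- by have := lt_block _ _ st si; rewrite ti.
- by have := lt_block _ _ st ti; rewrite si.
Qed.

Lemma in_block_exists (i : 'I_N) : exists s : 'I_n, in_block s i.
Proof.
pose S k := (\sum_(t < n | (t < k)%N) alpha t)%N.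
have S0 : S 0%N = 0%N by rewrite /S big_pred0.
have Sn : S n = N by apply: eq_bigl => t; rewrite ltn_ord.
have ex : exists k, (i < S k)%N by exists n; rewrite Sn.
(* The block of [i] is the predecessor of the least [k] whose partial sum exceeds [i]; this [k] is
   nonzero because [S 0] is 0. *)
case: (ex_minnP ex) => -[|k] ik kmin; first by rewrite S0 in ik.
have kn : (k < n)%N by have := kmin n; rewrite Sn ltn_ord; apply.
exists (Ordinal kn); rewrite /in_block /=; apply/andP; split=> //.
by rewrite leqNgt; apply/negP => /kmin; rewrite ltnn.
Qed.

Lemma same_block_sym (i j : 'I_N) : same_block i j = same_block j i.
Proof. by apply: eq_existsb => s; rewrite andbC. Qed.

Lemma sum_in_block (B : pzSemiRingType) (i j : 'I_N) :
  \sum_s (in_block s i && in_block s j)%:R = (same_block i j)%:R :> B.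
Proof.
rewrite /same_block; case: existsP => [[s /andP[si sj]]|nex].
  rewrite (bigD1 s) //= si sj big1 ?addr0 // => t ts.
  case: (boolP (in_block t i)) => //= ti.
  by rewrite (in_block_inj ti si) eqxx in ts.
by rewrite big1 // => s _; case: (boolP (_ && _)) => // sij; case: nex; exists s.
Qed.
End Blocks.

(** * The Casimir tensor of o_alpha *)

Section Casimir.
Variables (K : fieldType) (n : nat) (alpha : 'I_n -> nat).
Local Notation N := (total_dim alpha).
Hypothesis two_neq0 : 2%:R != 0 :> K.

Let proj (Y : 'M[K]_N) : 'M[K]_N :=
  \matrix_(p, q) if same_block p q then 2%:R^-1 * (Y p q - Y q p) else 0.

Lemma o_alpha_proj Y : o_alpha (proj Y).
Proof.
split=> [i j ij|]; first by rewrite mxE (negPf ij).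
apply/matrixP => i j; rewrite !mxE same_block_sym.
by case: ifP; rewrite ?oppr0 // -mulrN opprB.
Qed.

(** [proj] is the orthogonal projection onto o_alpha for the trace form: off-block entries of Y meet
    zeros of xi, and the symmetric part of Y pairs to zero with an antisymmetric matrix. *)
Lemma mxtrace_proj xi Y : o_alpha xi -> \tr (xi *m Y) = \tr (xi *m proj Y).
Proof.
move=> [xib xiT].
have asym p q : xi q p = - xi p q by have /matrixP/(_ p q) := xiT; rewrite !mxE.
have trE Z : \tr (xi *m Z) = \sum_p \sum_q xi p q * Z q p.
  by apply: eq_bigr => p _; rewrite mxE.
have blk p q : xi p q * proj Y q p = 2%:R^-1 * (xi p q * Y q p - xi p q * Y p q).
  rewrite mxE same_block_sym; case: ifP => [_|/negbT pq]; first by ring.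
  by rewrite (xib _ _ pq) !mul0r subr0 mulr0.
rewrite !trE; under [RHS]eq_bigr => p _.
  under eq_bigr => q _ do rewrite blk.
  rewrite -mulr_sumr sumrB; over.
rewrite -mulr_sumr sumrB.
have -> : \sum_p \sum_q xi p q * Y p q = - \sum_p \sum_q xi p q * Y q p.
  rewrite exchange_big /= -sumrN; apply: eq_bigr => p _.
  by rewrite -sumrN; apply: eq_bigr => q _; rewrite asym mulNr.
set S := \sum_p _; rewrite opprK.
by rewrite -[S + S]mulr2n -[S *+ 2]mulr_natl mulrA mulVf // mul1r.
Qed.

(* The Casimir tensor [sum_a F_a (x) F'_a] in coordinates. *)
Definition casimir_spec m (F F' : m.-tuple 'M[K]_N) := forall p q r s,
  \sum_a tnth F a p q * tnth F' a r s
  = if same_block p q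
    then 2%:R^-1 * (((p == s) && (q == r))%:R - ((p == r) && (q == s))%:R) else 0.

Lemma casimir_spec_sym m (F F' : m.-tuple 'M[K]_N) :
  casimir_spec F F' -> casimir_spec F' F.
Proof.
move=> hF p q r s; under eq_bigr => a _ do rewrite mulrC.
rewrite hF (eq_sym r q) (eq_sym s p) (eq_sym r p) (eq_sym s q) [(q == r) && _]andbC.
have sbE : ((p == s) && (q == r)) || ((p == r) && (q == s)) ->
    same_block r s = same_block p q.
  by case/orP => /andP[/eqP -> /eqP ->] //; rewrite same_block_sym.
case: (boolP (_ || _)) sbE => [_ -> //|/norP[/negPf -> /negPf ->] _].
by rewrite subrr mulr0; do 2 case: ifP.
Qed.

(** The entry (F'_a)_rs is the trace pairing of F'_a with the matrix unit E_sr, hence with its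
    projection, hence the a-th coordinate of that projection in the basis F. The sum over a
    therefore rebuilds the projected matrix unit. *)
Lemma casimir_o_alpha m (F F' : m.-tuple 'M[K]_N) :
  trace_dual_bases (@o_alpha n alpha K) F F' -> casimir_spec F F'.
Proof.
move=> [_ spanF oF' dualF] p q r s.
pose Y : 'M[K]_N := delta_mx s r.
have Yspan : proj Y \in <<F>>%VS by apply/spanF/o_alpha_proj.
have trY a : tnth F' a r s = coord F a (proj Y).
  rewrite -mxtrace_delta mxtrace_proj // {1}(coord_span Yspan).
  rewrite mulmx_sumr raddf_sum (bigD1 a) //= big1 ?addr0 => [|b ba].
    by rewrite -(tnth_nth 0) -scalemxAr linearZ /= mxtrace_mulC dualF eqxx mulr1.
  by rewrite -(tnth_nth 0) -scalemxAr linearZ /= mxtrace_mulC dualF (negPf ba) mulr0.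
under eq_bigr => a _ do rewrite trY.
have := congr1 (fun M : 'M[K]_N => M p q) (coord_span Yspan).
rewrite summxE mxE !mxE [(p == r) && _]andbC => ->.
by apply: eq_bigr => a _; rewrite mxE -(tnth_nth 0) mulrC.
Qed.
End Casimir.

Section BlockIdempotents.
Variables (B : comPzRingType) (n : nat) (alpha : 'I_n -> nat).
Local Notation N := (total_dim alpha).

Definition idem_mx (s : 'I_n) : 'M[B]_N :=
  \matrix_(i, j) [&& i == j, in_block s i & in_block s j]%:R.

Lemma idem_mx_diag s : idem_mx s = diag_mx (\row_i (in_block s i)%:R).
Proof.
apply/matrixP => i j; rewrite !mxE; case: eqVneq => [->|] //=.
by rewrite andbb mulr1n.
Qed.

Lemma idem_mx_conj s (M : 'M[B]_N) p q : (idem_mx s *m M *m idem_mx s) p q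
  = (in_block s p && in_block s q)%:R * M p q.
Proof.
rewrite idem_mx_diag mul_mx_diag mul_diag_mx !mxE.
by rewrite -mulnb natrM; ring.
Qed.

Lemma block_partE (M : 'M[B]_N) p q :
  block_part idem_mx M p q = if same_block p q then M p q else 0.
Proof.
rewrite summxE; under eq_bigr => s _ do rewrite idem_mx_conj.
by rewrite -mulr_suml sum_in_block; case: ifP; rewrite ?mul1r ?mul0r.
Qed.

Lemma asym_partE (M : 'M[B]_N) p q :
  asym_part idem_mx M p q = if same_block p q then M p q - M q p else 0.
Proof.
rewrite !mxE !block_partE same_block_sym.
by case: ifP => // _; rewrite subr0.
Qed.

Lemma sum_idem_mx : \sum_s idem_mx s = 1%:M.
Proof.
apply/matrixP => p q; rewrite summxE !mxE.
under eq_bigr => s _ do rewrite !mxE.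
case: eqVneq => [->|pq] /=; last by rewrite big1.
rewrite sum_in_block; have [s sq] := in_block_exists q.
by rewrite (_ : same_block q q) //; apply/existsP; exists s; rewrite sq.
Qed.

Lemma block_diagonal_comm (M : 'M[B]_N) s :
  (forall i j, ~~ same_block i j -> M i j = 0) -> idem_mx s *m M = M *m idem_mx s.
Proof.
move=> Mb; rewrite idem_mx_diag mul_mx_diag mul_diag_mx.
apply/matrixP => i j; rewrite !mxE.
have [ij|/Mb ->] := boolP (same_block i j); last by rewrite mulr0 mul0r.
have /existsP[t /andP[ti tj]] := ij.
suff -> : in_block s i = in_block s j by rewrite mulrC.
by apply/idP/idP => /in_block_inj h; [rewrite (h _ ti)|rewrite (h _ tj)].
Qed.
End BlockIdempotents.

Section ScalarMatrices.
Variables (K : fieldType) (B : comPzAlgType K) (N : nat).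

Definition in_alg_mx (M : 'M[K]_N) : 'M[B]_N := map_mx (fun k : K => k *: (1 : B)) M.

Lemma in_alg_mxM (P Q : 'M[K]_N) : in_alg_mx (P *m Q) = in_alg_mx P *m in_alg_mx Q.
Proof.
apply/matrixP => i j; rewrite !mxE scaler_suml; apply: eq_bigr => r _.
by rewrite !mxE -pzscalerAl mul1r scalerA.
Qed.
Lemma in_alg_mxB (P Q : 'M[K]_N) : in_alg_mx (P - Q) = in_alg_mx P - in_alg_mx Q.
Proof. by apply/matrixP => i j; rewrite !mxE scalerBl. Qed.
Lemma in_alg_mxN (P : 'M[K]_N) : in_alg_mx (- P) = - in_alg_mx P.
Proof. by apply/matrixP => i j; rewrite !mxE scaleNr. Qed.
Lemma in_alg_mx_tr (P : 'M[K]_N) : (in_alg_mx P)^T = in_alg_mx P^T.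
Proof. by apply/matrixP => i j; rewrite !mxE. Qed.
Lemma in_alg_mx1 : in_alg_mx 1%:M = 1%:M.
Proof. by apply/matrixP => i j; rewrite !mxE; case: eqP; rewrite ?scale1r ?scale0r. Qed.
Lemma mxtrace_in_alg (P : 'M[K]_N) : \tr (in_alg_mx P) = \tr P *: (1 : B).
Proof. by rewrite scaler_suml; apply: eq_bigr => i _; rewrite mxE. Qed.
End ScalarMatrices.
Arguments in_alg_mx {K} B {N}.

(** Contracting one leg of the Casimir tensor with P projects P to o_alpha with coefficients in B.
    The factor 1/2 is placed in B because matrices over B are scaled by elements of B. *)
Lemma casimir_asym_part (K : fieldType) (B : comPzAlgType K) (n : nat)
    (alpha : 'I_n -> nat) m (F F' : m.-tuple 'M[K]_(total_dim alpha))
    (P : 'M[B]_(total_dim alpha)) : casimir_spec F F' ->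
  \sum_a \tr (in_alg_mx B (tnth F a) *m P) *: in_alg_mx B (tnth F' a)
  = (2%:R^-1 *: (1 : B)) *: asym_part (@idem_mx B n alpha) P.
Proof.
move=> hF; apply/matrixP => r s; rewrite summxE.
have trE a : (\tr (in_alg_mx B (tnth F a) *m P) *: in_alg_mx B (tnth F' a)) r s
   = \sum_p \sum_q (tnth F a p q * tnth F' a r s) *: P q p.
  rewrite !mxE mulr_suml; apply: eq_bigr => p _; rewrite mxE mulr_suml.
  apply: eq_bigr => q _; rewrite mxE -!pzscalerAl -pzscalerAr mul1r mulr1 scalerA.
  by rewrite mulrC.
under eq_bigr => a _ do rewrite trE.
rewrite exchange_big; under eq_bigr => p _.
  rewrite exchange_big; under eq_bigr => q _.
    rewrite -scaler_suml hF; over.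
  over.
rewrite mxE asym_partE -pzscalerAl mul1r.
transitivity (\sum_p \sum_q 2%:R^-1 *: ((if same_block p q then P q p else 0)
   * ((p == s) && (q == r))%:R - (if same_block p q then P q p else 0)
   * ((p == r) && (q == s))%:R)).
  apply: eq_bigr => p _; apply: eq_bigr => q _.
  case: ifP => _; last by rewrite !mul0r subr0 scaler0 scale0r.
  rewrite -scalerA; congr (_ *: _); rewrite scalerBl.
  by rewrite !mulr_natr !scaler_nat.
have delta_sum (f : 'I_(total_dim alpha) -> 'I_(total_dim alpha) -> B) s' r' :
    \sum_p \sum_q f p q * ((p == s') && (q == r'))%:R = f s' r'.
  rewrite (bigD1 s') //= (bigD1 r') //= !eqxx mulr1 !big1 ?addr0 //.
  - move=> p ps; rewrite big1 // => q _; by rewrite (negPf ps) mulr0.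
  - by move=> q qr; rewrite (negPf qr) mulr0.
under eq_bigr => p _ do rewrite -scaler_sumr.
rewrite -scaler_sumr; congr (_ *: _).
under eq_bigr => p _ do rewrite sumrB.
rewrite sumrB !delta_sum same_block_sym.
by case: ifP => // _; rewrite subr0.
Qed.

Lemma derivation_commutator (K : pzRingType) (B : comPzAlgType K) (D D' : B -> B) :
  derivation_along id D -> derivation_along id D' ->
  derivation_along id (fun f => D (D' f) - D' (D f)).
Proof.
move=> [lD DM] [lD' DM']; split=> [k f g|f g].
  by rewrite lD' lD lD lD' scalerBr; ring.
rewrite DM' DM (linear_funD lD) (linear_funD lD') !DM !DM'.
ring.
Qed.

Lemma biderivation_r (K : fieldType) (B : comPzAlgType K) (br : B -> B -> B) f :
  antisym_biderivation br -> derivation_along id (br f).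
Proof. by move=> [[_ lbr] _ brM _]; split=> // g h; rewrite brM. Qed.

Lemma biderivation_l (K : fieldType) (B : comPzAlgType K) (br : B -> B -> B) f :
  antisym_biderivation br -> derivation_along id (br^~ f).
Proof. by move=> [[lbr _] _ _ brM]; split=> // g h; rewrite brM. Qed.

(** This form shows that the Jacobiator is a derivation in h: a commutator of two Hamiltonian
    derivations minus a third one. *)
Lemma jacobiator_commutator (K : fieldType) (B : comPzAlgType K)
    (br : B -> B -> B) f g h : antisym_biderivation br ->
  br f (br g h) + br g (br h f) + br h (br f g)
  = br f (br g h) - br g (br f h) - br (br f g) h.
Proof.
move=> [[_ lbr] anti _ _]; rewrite [br h f]anti (linear_funN (lbr g)).
by rewrite [br h (br f g)]anti.
Qed.

Lemma mxtrace_commutator_scale (B : comPzRingType) (N : nat) (k : B) (P Q R : 'M[B]_N) :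
  \tr ((k *: P) *m ((k *: Q) *m (k *: R) - (k *: R) *m (k *: Q)))
  = k * (k * (k * \tr (P *m (Q *m R - R *m Q)))).
Proof. by rewrite -!(scalemxAl, scalemxAr, scalerBr) !linearZ. Qed.

Section CartanTrivector.
Variables (K : fieldType) (B : comPzAlgType K) (N m : nat).
Variables (F F' : m.-tuple 'M[K]_N) (inf : 'M[K]_N -> B -> B).

(* The image in [g (x) B] of the differential of [f] under the trace form.      *)
Definition moment_grad (f : B) : 'M[B]_N :=
  \sum_a inf (tnth F a) f *: in_alg_mx B (tnth F' a).

Let T f g h := \tr (moment_grad f *m
  (moment_grad g *m moment_grad h - moment_grad h *m moment_grad g)).

Lemma mxtrace_moment_grad f g h :
  \sum_a \sum_b \sum_c
    \tr (tnth F' a *m (tnth F' b *m tnth F' c - tnth F' c *m tnth F' b))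
    *: (inf (tnth F a) f * inf (tnth F b) g * inf (tnth F c) h) = T f g h.
Proof.
have GG u v : moment_grad u *m moment_grad v = \sum_a \sum_b
    (inf (tnth F a) u * inf (tnth F b) v) *: in_alg_mx B (tnth F' a *m tnth F' b).
  rewrite /moment_grad mulmx_suml; apply: eq_bigr => a _.
  rewrite mulmx_sumr; apply: eq_bigr => b _.
  by rewrite -scalemxAl -scalemxAr scalerA in_alg_mxM.
rewrite /T !GG [X in _ - X]exchange_big /= -sumrB /moment_grad mulmx_suml raddf_sum.
apply: eq_bigr => a _ /=; rewrite mulmx_sumr raddf_sum; apply: eq_bigr => b _ /=.
rewrite -sumrB mulmx_sumr raddf_sum; apply: eq_bigr => c _ /=.
rewrite [inf _ h * _]mulrC -scalerBr -scalemxAl -scalemxAr scalerA -in_alg_mxB.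
rewrite -in_alg_mxM linearZ /= mxtrace_in_alg -pzscalerAr mulr1.
by rewrite mulrA.
Qed.

Lemma mxtrace_commutator_anti (P Q R : 'M[B]_N) :
  \tr (P *m (R *m Q - Q *m R)) = - \tr (P *m (Q *m R - R *m Q)).
Proof. by rewrite -[R *m Q - _]opprB mulmxN raddfN. Qed.

Lemma mxtrace_commutator_cyclic (P Q R : 'M[B]_N) :
  \tr (Q *m (R *m P - P *m R)) = \tr (P *m (Q *m R - R *m Q)).
Proof.
rewrite !mulmxBr !raddfB /= !mulmxA [\tr (Q *m R *m P)]mxtrace_mulC.
by rewrite [\tr (Q *m P *m R)]mxtrace_mulC !mulmxA
  [\tr (R *m Q *m P)]mxtrace_mulC !mulmxA.
Qed.

(** The trace of P [Q, R] is totally antisymmetric, so the six terms of the wedge contribute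
    equally, and 6/12 = 1/2. *)
Lemma cartan_trivectorE f g h : 12%:R != 0 :> K ->
  cartan_trivector inf F F' f g h = 2%:R^-1 *: T f g h.
Proof.
move=> nz12; rewrite /cartan_trivector.
have six : 2%:R^-1 = 12%:R^-1 * 6%:R :> K.
  have : (2 * 6)%N%:R != 0 :> K by [].
  rewrite -[12%N]/(2 * 6)%N natrM mulf_eq0 negb_or => /andP[_ nz6].
  by rewrite invfM mulfVK.
rewrite six -scalerA; congr (_ *: _).
have -> : 6%:R *: T f g h
    = T f g h - T f h g - T g f h + T g h f + T h f g - T h g f.
  have TA u v w : T u w v = - T u v w by apply: mxtrace_commutator_anti.
  have TC u v w : T v w u = T u v w by apply: mxtrace_commutator_cyclic.
  rewrite (TC h g f) (TC f h g) (TC g h f) (TC f g h) (TA f g h) scaler_nat.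
  by move: (T f g h) => t; ring.
rewrite -!mxtrace_moment_grad -!(sumrB, big_split) /=; apply: eq_bigr => a _.
rewrite -!(sumrB, big_split) /=; apply: eq_bigr => b _.
rewrite -!(sumrB, big_split) /=; apply: eq_bigr => c _.
rewrite -!scalerBr -!scalerDr -!scalerBr; congr (_ *: _).
exact: wedge3E.
Qed.
End CartanTrivector.

(** * Quasi-Poisson and moment map identities *)

Section QuasiPoissonRepresentation.
Variables (K : fieldType) (A : pzAlgType K) (B : comPzAlgType K).
Variables (n : nat) (alpha : 'I_n -> nat).
Local Notation N := (total_dim alpha).
Variables (e : 'I_n -> A) (dbr : A -> A -> tensor A A) (phi : A -> A).
Variable x : A -> 'I_N -> 'I_N -> B.
Hypothesis he : idempotent_decomposition e.
Hypothesis hdbr : double_quasi_poisson e dbr.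
Hypothesis hphi : compatible_involution e dbr phi.
Hypothesis lx : forall i j, linear (fun a => x a i j).
Hypothesis xM : forall a b i j, x (a * b) i j = \sum_r x a i r * x b r j.
Hypothesis xe : forall s, \matrix_(i, j) x (e s) i j = idem_mx B alpha s.
Hypothesis xphi : forall a i j, x (phi a) i j = x a j i.
Variable br : B -> B -> B.
Hypothesis hbr : antisym_biderivation br.
Hypothesis brE : forall a b i j k l, br (x a i j) (x b k l)
  = 2%:R^-1 *: ev2 x k j i l (dbr a b) + 2%:R^-1 *: ev2 x k i j l (dbr (phi a) b).
Hypothesis x_ext : forall D D' : B -> B,
  derivation_along id D -> derivation_along id D' ->
  (forall a i j, D (x a i j) = D' (x a i j)) -> D =1 D'.
Variable inf : 'M[K]_N -> B -> B.
Hypothesis inf_der : forall xi, o_alpha xi -> derivation_along id (inf xi).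
Local Notation X a := (\matrix_(i, j) x a i j).
Local Notation M a i j := (grad_mx (X a) i j).
Local Notation E := (@idem_mx B n alpha).
Hypothesis infE : forall xi, o_alpha xi -> forall a i j,
  inf xi (x a i j) = \tr (in_alg_mx B xi *m M a i j).
Hypothesis nz12 : 12%:R != 0 :> K.

Let two_neq0 : 2%:R != 0 :> K.
Proof.
by have : (2 * 6)%N%:R != 0 :> K by []; rewrite natrM mulf_eq0 negb_or => /andP[].
Qed.

Let EE : (fun s => X (e s)) = E.
Proof. exact/funext/xe. Qed.

Lemma idem_mx_mul s t : E s *m E t = if s == t then E s else 0.
Proof. by rewrite -!xe (mx_idem he lx xM). Qed.

Section DualBases.
Variables (m : nat) (F F' : m.-tuple 'M[K]_N).
Hypothesis hF : trace_dual_bases (@o_alpha n alpha K) F F'.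

Let oF a : o_alpha (tnth F a).
Proof. by have [_ spanF _ _] := hF; apply/spanF/memv_span/mem_tnth. Qed.
Let oF' a : o_alpha (tnth F' a).
Proof. by have [_ _ oF' _] := hF; apply: oF'. Qed.

Lemma moment_gradE a i j : moment_grad F F' inf (x a i j)
  = (2%:R^-1 *: (1 : B)) *: asym_part E (M a i j).
Proof.
rewrite -(casimir_asym_part _ (casimir_o_alpha two_neq0 hF)).
by apply: eq_bigr => c _; rewrite infE.
Qed.

Let T f g h := \tr (moment_grad F F' inf f *m
  (moment_grad F F' inf g *m moment_grad F F' inf h
   - moment_grad F F' inf h *m moment_grad F F' inf g)).

Lemma derivation_moment_grad3 f g : derivation_along id (T f g).
Proof.
have -> : T f g = fun h => \sum_c
   \tr ((moment_grad F F' inf f *m moment_grad F F' inf g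
         - moment_grad F F' inf g *m moment_grad F F' inf f)
        *m in_alg_mx B (tnth F' c)) * inf (tnth F c) h.
  apply/funext => h; rewrite /T -mxtrace_commutator_cyclic -mxtrace_commutator_cyclic.
  rewrite mxtrace_mulC {3}/moment_grad mulmx_sumr raddf_sum; apply: eq_bigr => c _ /=.
  by rewrite -scalemxAr linearZ /= mulrC.
apply: derivation_along_sum => c; apply: derivation_along_mull; exact: inf_der.
Qed.

Lemma jacobi_cartan_trivector f g h :
  br f (br g h) + br g (br h f) + br h (br f g)
  = 2%:R^-1 *: cartan_trivector inf F F' f g h.
Proof.
rewrite cartan_trivectorE // scalerA -invfM -natrM -/(T f g h).
pose J f g h := br f (br g h) + br g (br h f) + br h (br f g).
have Jder u v : derivation_along id (J u v).
  have -> : J u v = fun w => (br u (br v w) - br v (br u w)) + - br (br u v) w.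
    by apply/funext => w; rewrite /J jacobiator_commutator.
  apply: derivation_along_add.
    by apply: derivation_commutator; apply: biderivation_r.
  exact/derivation_along_opp/biderivation_r.
have Tder u v : derivation_along id (fun w => (2 * 2)%N%:R^-1 *: T u v w).
  exact/derivation_along_scale/derivation_moment_grad3.
have JC u v w : J u v w = J v w u by rewrite /J -addrA addrC.
have TC u v w : T u v w = T v w u by exact/esym/mxtrace_commutator_cyclic.
rewrite -/(J f g h).
(* Both sides are derivations in the last slot and cyclically invariant. Rotating each argument in
   turn into that slot replaces all three by coordinates. *)
have J3 a i j b k l w : J (x a i j) (x b k l) w
    = (2 * 2)%N%:R^-1 *: T (x a i j) (x b k l) w.
  move: w; apply: x_ext => // c u v.
  have := jacobi_asym he hdbr hphi lx xM xphi hbr brE two_neq0 a i j b k l c u v.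
  rewrite EE => jac; apply: etrans jac _.
  rewrite /T !moment_gradE mxtrace_commutator_scale.
  by rewrite -!pzscalerAl !mul1r !scalerA -!invfM -!natrM.
have J2 a i j v w : J (x a i j) v w = (2 * 2)%N%:R^-1 *: T (x a i j) v w.
  rewrite JC JC TC TC; move: v; apply: x_ext => // b k l.
  by rewrite JC TC J3.
rewrite JC TC; move: f; apply: x_ext => // a i j.
by rewrite -JC -TC J2.
Qed.

(** * The moment map identity on coordinates *)

Section MomentMap.
Variable Phi : A.
Hypothesis hPhi : double_moment_map e dbr Phi.
Hypothesis PhiK : phi Phi * Phi = 1.

Let bdbr : bilin dbr. Proof. by case: hdbr => -[]. Qed.

(** Membership of the components in e_s A e_s forces Phi_s = Phi e_s = e_s Phi, so Phi commutes with
    the idempotents and X(Phi) is block diagonal. *)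
Lemma moment_map_components : exists2 Phis : 'I_n -> A,
  [/\ Phi = \sum_s Phis s, forall s, Phis s = Phi * e s & forall s, Phis s = e s * Phi]
  & forall s a, dbr (Phis s) a = 2%:R^-1 *:
          (  (a * e s) \ox Phis s - e s \ox (Phis s * a)
           + (a * Phis s) \ox e s - Phis s \ox (e s * a)).
Proof.
have [ee _] := he; have [_ [Phis [PhiE Phisb PhisD]]] := hPhi.
exists Phis => //; split=> // t; rewrite PhiE.
  rewrite mulr_suml (bigD1 t) //= big1 ?addr0 => [|u ut].
    by have [y ->] := Phisb t; rewrite -[RHS]mulrA ee eqxx.
  by have [y ->] := Phisb u; rewrite -mulrA ee (negPf ut) mulr0.
rewrite mulr_sumr (bigD1 t) //= big1 ?addr0 => [|u ut].
  by have [y ->] := Phisb t; rewrite !mulrA ee eqxx.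
by have [y ->] := Phisb u; rewrite !mulrA ee eq_sym (negPf ut) !mul0r.
Qed.

Lemma moment_idem_comm s : E s *m X Phi = X Phi *m E s.
Proof.
have [Phis [_ Pr Pl] _] := moment_map_components.
by rewrite -!xe -!(mx_mulE xM) -Pl Pr.
Qed.

Lemma moment_map_same_block i j : ~~ same_block i j -> x Phi i j = 0.
Proof.
move=> ij; have [_ e1] := he.
have -> : x Phi i j = (\sum_s E s *m X Phi *m E s) i j.
  transitivity ((X Phi *m 1%:M) i j); first by rewrite mulmx1 mxE.
  rewrite -sum_idem_mx mulmx_sumr; congr (fun_of_matrix _ i j).
  apply: eq_bigr => s _; rewrite moment_idem_comm -mulmxA; congr (_ *m _).
  by rewrite idem_mx_mul eqxx.
by rewrite -/(block_part E _) block_partE (negPf ij).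
Qed.

Lemma mx_1 : X 1 = 1%:M.
Proof.
have [_ <-] := he; rewrite -(sum_idem_mx B alpha); apply/matrixP => i j.
rewrite mxE (linear_fun_sum (lx i j)) summxE; apply: eq_bigr => s _.
by rewrite -xe mxE.
Qed.

Lemma moment_orthogonal : (X Phi)^T *m X Phi = 1%:M.
Proof. by rewrite -(mx_phiE xphi) -(mx_mulE xM) PhiK mx_1. Qed.

Lemma moment_orthogonal' : X Phi *m (X Phi)^T = 1%:M.
Proof.
have [[Psi [PhiPsi PsiPhi]] _] := hPhi.
have phiPhi : phi Phi = Psi by rewrite -[phi Phi]mulr1 -PhiPsi mulrA PhiK mul1r.
by rewrite -(mx_phiE xphi) -(mx_mulE xM) phiPhi PhiPsi mx_1.
Qed.

(* The coordinates of [{a_ij, b_kl}] before symmetrization by [phi]. *)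
Let D a b k l : 'M[B]_N := \matrix_(i, j) ev2 x k j i l (dbr a b).

Lemma D_mul a c b k l : D (a * c) b k l = D a b k l *m X c + X a *m D c b k l.
Proof.
have [[_ _ _ DM _] _] := hdbr.
apply/matrixP => i j; rewrite !mxE DM (linear_funD (ev2_linear lx _ _ _ _)).
rewrite ev2_inner1l // ev2_inner1r //.
by congr (_ + _); apply: eq_bigr => r _; rewrite !mxE.
Qed.

Lemma D_1 b k l : D 1 b k l = 0.
Proof.
have [[_ _ _ _ D0] _] := hdbr; have [_ e1] := he.
apply/matrixP => i j; rewrite !mxE; have [+ _] := D0 (fun=> 1) b.
under eq_bigr => s _ do rewrite scale1r.
by rewrite e1 => ->; rewrite (linear_fun0 (ev2_linear lx _ _ _ _)).
Qed.

(** For each s, [mul_mx_gradE] recognizes the four terms of the double moment map condition as the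
    entries of X(Phi_s) M E_s + E_s M X(Phi_s), with M the commutator attached to b_kl. *)
Lemma D_moment b k l (bM := block_part E (M b k l)) :
  D Phi b k l = (2%:R^-1 *: (1 : B)) *: (X Phi *m bM + bM *m X Phi).
Proof.
have [Phis [PhiE Pr Pl] PhisD] := moment_map_components.
have [ldbr _] := bdbr.
have XPhi : X Phi = \sum_s X (Phis s).
  apply/matrixP => i j; rewrite mxE PhiE (linear_fun_sum (lx i j)) summxE.
  by apply: eq_bigr => s _; rewrite mxE.
have bl1 : X Phi *m bM = \sum_s X (Phis s) *m M b k l *m E s.
  rewrite mulmx_sumr; apply: eq_bigr => s _.
  by rewrite Pr mx_mulE // xe !mulmxA.
have bl2 : bM *m X Phi = \sum_s E s *m M b k l *m X (Phis s).
  rewrite mulmx_suml; apply: eq_bigr => s _.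
  by rewrite Pl mx_mulE // xe !mulmxA.
apply/matrixP => i j; rewrite bl1 bl2 -big_split /= mxE PhiE.
rewrite (linear_fun_sum (ldbr b)) (linear_fun_sum (ev2_linear lx _ _ _ _)).
rewrite mxE summxE mulr_sumr; apply: eq_bigr => s _.
rewrite PhisD (linear_funZ (ev2_linear lx _ _ _ _)) -pzscalerAl mul1r.
congr (_ *: _); have le := ev2_linear lx k j i l.
rewrite !(linear_funB le, linear_funD le) !ev2_pure // [RHS]mxE !mul_mx_gradE.
have xX a p q : x a p q = X a p q by rewrite mxE.
rewrite !xX !(mx_mulE xM) !xe.
ring.
Qed.

(** The Leibniz rule applied to phi(Phi) Phi = 1 expresses the bracket of phi(Phi) as that of Phi
    multiplied on both sides by -X(Phi)^T and X(Phi)^T; orthogonality simplifies the outcome. *)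
Lemma D_phi_moment b k l (bM := block_part E (M b k l)) :
  (D (phi Phi) b k l)^T
  = - ((2%:R^-1 *: (1 : B)) *: (X Phi *m bM^T + bM^T *m X Phi)).
Proof.
have : D (phi Phi) b k l *m X Phi = - (X (phi Phi) *m D Phi b k l).
  by apply/eqP; rewrite -addr_eq0 -D_mul PhiK D_1.
move=> /(congr1 (mulmx^~ (X Phi)^T)); rewrite -mulmxA moment_orthogonal' mulmx1 => ->.
rewrite D_moment (mx_phiE xphi) -/bM mulNmx -scalemxAr -scalemxAl.
rewrite mulmxDr mulmxDl !mulmxA moment_orthogonal mul1mx -(mulmxA _ _ (X Phi)^T).
rewrite moment_orthogonal' mulmx1 !raddfN /= linearZ /= raddfD /= !trmx_mul trmxK.
by rewrite addrC.
Qed.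

Lemma moment_map_bracket i j f : br (x Phi i j) f
  = 2%:R^-1 *: \sum_a (X Phi *m in_alg_mx B (tnth F a)
      + in_alg_mx B (tnth F a) *m X Phi) i j * inf (tnth F' a) f.
Proof.
move: f; apply: x_ext => [||b k l].
- exact: biderivation_r.
- apply: derivation_along_scale; apply: derivation_along_sum => a.
  exact/derivation_along_mull/inf_der.
(* Here the vector fields run over the dual basis, so the Casimir identity is used with [F] and [F']
   exchanged. *)
have casF := casimir_spec_sym (casimir_o_alpha two_neq0 hF).
have -> : \sum_a (X Phi *m in_alg_mx B (tnth F a)
      + in_alg_mx B (tnth F a) *m X Phi) i j * inf (tnth F' a) (x b k l)
    = (X Phi *m ((2%:R^-1 *: (1 : B)) *: asym_part E (M b k l))
       + ((2%:R^-1 *: (1 : B)) *: asym_part E (M b k l)) *m X Phi) i j.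
  rewrite -(casimir_asym_part _ casF) mulmx_sumr mulmx_suml -big_split summxE.
  apply: eq_bigr => a _ /=; rewrite infE // -scalemxAr -scalemxAl -scalerDr.
  by rewrite [RHS]mxE mulrC.
rewrite brE -scalerDr; congr (_ *: _).
transitivity ((D Phi b k l + (D (phi Phi) b k l)^T) i j); first by rewrite !mxE.
congr (fun_of_matrix _ i j); rewrite D_moment D_phi_moment -scalemxAr -scalemxAl.
rewrite -scalerDr -scalerBr; congr (_ *: _).
rewrite /asym_part mulmxBr mulmxBl opprD.
by rewrite addrACA.
Qed.

End MomentMap.
End DualBases.
End QuasiPoissonRepresentation.

(** * Coordinate rings, bracket and actions *)

Lemma peval_big (K : pzRingType) (X : Type) (S : pzAlgType K) (v : X -> S)
    (I : Type) (r : seq I) (F : I -> pterm K X) :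
  peval v (\big[@PAdd K X/PConst 0]_(i <- r) F i) = \sum_(i <- r) peval v (F i).
Proof. by apply: big_morph => //=; rewrite scale0r. Qed.

Section DualNumberFacts.
Variables (K : fieldType) (B : comPzAlgType K).

Lemma dual_eq (u v : dual B) : u.1 = v.1 -> u.2 = v.2 -> u = v.
Proof. by case: u v => [u u'] [v v'] /= -> ->. Qed.

Lemma dual_sum1 (I : Type) (r : seq I) (F : I -> dual B) :
  (\sum_(i <- r) F i).1 = \sum_(i <- r) (F i).1.
Proof. exact: (big_morph (fun u : dual B => u.1)). Qed.

Lemma dual_sum2 (I : Type) (r : seq I) (F : I -> dual B) :
  (\sum_(i <- r) F i).2 = \sum_(i <- r) (F i).2.
Proof. exact: (big_morph (fun u : dual B => u.2)). Qed.

Lemma dual_natr1 m : (m%:R : dual B).1 = m%:R.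
Proof. by elim: m => // m IH; rewrite !mulrS -IH. Qed.

Lemma dual_natr2 m : (m%:R : dual B).2 = 0.
Proof. by elim: m => // m IH; rewrite mulrS -[RHS]addr0 -{2}IH. Qed.

Lemma dual_inj_hom : alg_hom (@dual_inj K B).
Proof.
split=> [k f g|]; first by apply: dual_eq => //=; rewrite scaler0 addr0.
by split=> // f g; apply: dual_eq => //=; rewrite mulr0 mul0r addr0.
Qed.
End DualNumberFacts.

Section RepresentationRing.
Variables (K : fieldType) (A : pzAlgType K) (n : nat) (e : 'I_n -> A).
Variables (phi : A -> A) (alpha : 'I_n -> nat).
Local Notation N := (total_dim alpha).
Local Notation R := (rep_phi_ring e phi alpha).
Local Notation rel := (@rep_phi_rel K A n e phi alpha).
Local Notation x := (a_ e phi (alpha := alpha)).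

(** The universal property of the coordinate ring: such a [Y] is a C-point of the representation
    scheme. *)
Lemma peval_rep_phi_rel (C : comPzAlgType K) (Y : A -> 'M[C]_N) :
  (forall i j, linear (fun a => Y a i j)) ->
  (forall a b, Y (a * b) = Y a *m Y b) ->
  (forall s, Y (e s) = idem_mx C alpha s) ->
  (forall a, Y (phi a) = (Y a)^T) ->
  forall s t, rel s t ->
    peval (fun z => Y z.1.1 z.1.2 z.2) s = peval (fun z => Y z.1.1 z.1.2 z.2) t.
Proof.
move=> lY YM Ye Yphi s t [|a i j] /=; last by rewrite Yphi mxE.
move=> {}s {}t [a b i j|k a i j|a b i j|r i j] /=.
- exact: linear_funD (lY i j) _ _.
- by rewrite -pzscalerAl mul1r; exact: linear_funZ (lY i j) _ _.
- by rewrite YM mxE peval_big.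
- by rewrite Ye mxE scaler_nat.
Qed.

Lemma rep_rel_eq s t : rel s t -> peval (gen rel) s = peval (gen rel) t.
Proof.
move=> st; have /= E r := peval_gen r (@alg_hom_id K (presented rel)).
by rewrite !E; apply/pclassE/pc_rel.
Qed.

Lemma rep_linear i j : linear (fun a => x a i j).
Proof.
move=> k a b.
have E1 : x (k *: a + b) i j = x (k *: a) i j + x b i j.
  exact: (rep_rel_eq (rep_phi_rep phi (rep_add e (k *: a) b i j))).
have E2 : x (k *: a) i j = (k *: (1 : R)) * x a i j.
  exact: (rep_rel_eq (rep_phi_rep phi (rep_scale e k a i j))).
by rewrite E1 E2 -pzscalerAl mul1r.
Qed.

Lemma rep_mulE a b i j : x (a * b) i j = \sum_r x a i r * x b r j.
Proof.
apply: etrans (rep_rel_eq (rep_phi_rep phi (rep_mul e a b i j))) _.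
by rewrite peval_big.
Qed.

Lemma rep_idemE s : X_ e phi alpha (e s) = idem_mx R alpha s.
Proof.
apply/matrixP => i j; rewrite !mxE.
apply: etrans (rep_rel_eq (rep_phi_rep phi (rep_idem e s i j))) _.
by rewrite /= scaler_nat.
Qed.

Lemma rep_phiE a i j : x (phi a) i j = x a j i.
Proof. exact: (rep_rel_eq (rep_phi_tau e phi a i j)). Qed.

Lemma rep_derivation_ext (C : comPzAlgType K) (s D D' : R -> C) : alg_hom s ->
  derivation_along s D -> derivation_along s D' ->
  (forall a i j, D (x a i j) = D' (x a i j)) -> D =1 D'.
Proof.
move=> hs hD hD' DD'; apply: (derivation_along_ext hs hD hD').
by case=> -[a i] j; apply: DD'.
Qed.

(* Conjugation by an orthogonal block diagonal matrix with entries in any       *)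
(* algebra; dual numbers give the infinitesimal action.                        *)
Lemma conj_rep_phi_rel (C : comPzAlgType K) (s : R -> C) (P Q : 'M[C]_N) :
  alg_hom s -> P *m Q = 1%:M -> Q *m P = 1%:M -> P^T = Q ->
  (forall t, idem_mx C alpha t *m P = P *m idem_mx C alpha t) ->
  let v (z : A * 'I_N * 'I_N) := (Q *m map_mx s (X_ e phi alpha z.1.1) *m P) z.1.2 z.2 in
  forall r t, rel r t -> peval v r = peval v t.
Proof.
move=> [ls [s1 sM]] PQ QP PT comm v.
apply: (@peval_rep_phi_rel C (fun a => Q *m map_mx s (X_ e phi alpha a) *m P)).
- move=> i j k a b /=.
  have -> : map_mx s (X_ e phi alpha (k *: a + b))
      = (k *: (1 : C)) *: map_mx s (X_ e phi alpha a) + map_mx s (X_ e phi alpha b).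
    apply/matrixP => i' j'; rewrite !mxE rep_linear ls.
    by rewrite -pzscalerAl mul1r.
  by rewrite mulmxDr mulmxDl -scalemxAr -scalemxAl mxE mxE -pzscalerAl mul1r.
- move=> a b.
  have -> : map_mx s (X_ e phi alpha (a * b))
      = map_mx s (X_ e phi alpha a) *m map_mx s (X_ e phi alpha b).
    apply/matrixP => i j; rewrite !mxE rep_mulE (linear_fun_sum ls).
    by apply: eq_bigr => r _; rewrite sM !mxE.
  by rewrite !mulmxA -(mulmxA _ P Q) PQ mulmx1.
- move=> t; rewrite rep_idemE.
  have -> : map_mx s (idem_mx R alpha t) = idem_mx C alpha t.
    apply/matrixP => i j; rewrite !mxE.
    by case: (_ && _); rewrite ?s1 // (linear_fun0 ls).
  by rewrite -mulmxA comm mulmxA QP mul1mx.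
- move=> a; have QT : Q^T = P by rewrite -PT trmxK.
  rewrite !trmx_mul PT QT mulmxA; congr (_ *m _ *m _); apply/matrixP => i j.
  by rewrite !mxE rep_phiE.
Qed.
End RepresentationRing.

(** * Existence of the bracket *)

Section RepresentationBracket.
Variables (K : fieldType) (A : pzAlgType K) (n : nat) (e : 'I_n -> A).
Variables (dbr : A -> A -> tensor A A) (phi : A -> A) (alpha : 'I_n -> nat).
Hypothesis hdbr : double_bracket e dbr.
Hypothesis hphi : compatible_involution e dbr phi.
Local Notation N := (total_dim alpha).
Local Notation R := (rep_phi_ring e phi alpha).
Local Notation rel := (@rep_phi_rel K A n e phi alpha).
Local Notation x := (a_ e phi (alpha := alpha)).
Local Notation lx := (rep_linear e phi (alpha := alpha)).
Local Notation xM := (rep_mulE e phi (alpha := alpha)).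

Let c a (i j : 'I_N) b k l : R :=
  2%:R^-1 *: ev2 x k j i l (dbr a b) + 2%:R^-1 *: ev2 x k i j l (dbr (phi a) b).

Let bdbr : bilin dbr. Proof. by case: hdbr. Qed.
Let lphi : linear phi. Proof. by case: hphi. Qed.
Let phiK : involutive phi. Proof. by case: hphi. Qed.

Let ev2_phi a b i j k l :
  ev2 x k j i l (dbr (phi a) (phi b)) = ev2 x l i j k (dbr a b).
Proof.
by rewrite (double_antisym_phi _ _ hphi) (ev2_swap lx)
  (ev2_tmap2 lx lphi (rep_phiE e phi (alpha := alpha))).
Qed.

Let c_anti a i j b k l : c b k l a i j = - c a i j b k l.
Proof.
have [_ anti _ _ _] := hdbr; rewrite /c opprD -!scalerN.
have evN p q r s u v : ev2 x p q r s (dbr u v) = - ev2 x r s p q (dbr v u).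
  by rewrite anti (linear_funN (ev2_linear lx _ _ _ _)) (ev2_swap lx).
congr (_ *: _ + _ *: _); first exact: evN.
by rewrite -[a in LHS]phiK ev2_phi evN.
Qed.

Let c_linear a i j k l : linear (fun b => c a i j b k l).
Proof.
have [_ dr] := bdbr.
by apply: linear_add; apply: linear_scaler;
  apply: linear_comp (ev2_linear lx _ _ _ _) (dr _).
Qed.

Let c_mul a i j b d k l :
  c a i j (b * d) k l = \sum_r (x b k r * c a i j d r l + c a i j b k r * x d r l).
Proof.
have [_ _ DM _ _] := hdbr.
have evM p q r u : ev2 x p q r l (dbr u (b * d))
    = \sum_s (x b p s * ev2 x s q r l (dbr u d) + ev2 x p q r s (dbr u b) * x d s l).
  rewrite DM (linear_funD (ev2_linear lx _ _ _ _)) (ev2_outer1l lx xM)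
    (ev2_outer1r lx xM).
  by rewrite addrC big_split.
rewrite /c !evM !scaler_sumr -big_split; apply: eq_bigr => r _ /=.
rewrite !scalerDr mulrDl mulrDr -!(pzscalerAl, pzscalerAr).
by rewrite addrACA.
Qed.

Let c_idem a i j s k l : c a i j (e s) k l = 0.
Proof.
have [_ _ _ _ D0] := hdbr.
have De u : dbr u (e s) = 0.
  have [_ <-] := D0 (fun t => (t == s)%:R) u; congr (dbr u _).
  by rewrite (bigD1 s) //= eqxx scale1r big1 ?addr0 // => t /negPf ->; rewrite scale0r.
by rewrite /c !De !(linear_fun0 (ev2_linear lx _ _ _ _)) !scaler0 addr0.
Qed.

Let c_phi a i j b k l : c a i j (phi b) l k = c a i j b k l.
Proof.
rewrite /c ev2_phi addrC; congr (_ *: _ + _ *: _).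
by rewrite -[a in LHS]phiK ev2_phi.
Qed.

(** The hypotheses on [w] are the linearized defining relations: they say that X(a) + w(a) eps is a
    point over the dual numbers. *)
Let dual_rel (w : A -> 'I_N -> 'I_N -> R) :
  (forall i j, linear (fun a => w a i j)) ->
  (forall a b i j, w (a * b) i j = \sum_r (x a i r * w b r j + w a i r * x b r j)) ->
  (forall s i j, w (e s) i j = 0) -> (forall a i j, w (phi a) i j = w a j i) ->
  let W (z : A * 'I_N * 'I_N) : dual R := (gen rel z, w z.1.1 z.1.2 z.2) in
  forall s t, rel s t -> eps_coef (peval W s) = eps_coef (peval W t).
Proof.
move=> lw wM we wphi W s t st; congr eps_coef.
pose Y a : 'M[dual R]_N := \matrix_(i, j) ((x a i j, w a i j) : dual R).
have -> : W = fun z => Y z.1.1 z.1.2 z.2.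
  by apply/funext => -[[a i] j]; rewrite mxE.
apply: peval_rep_phi_rel st => [i j k a b|a b|u|a].
- by rewrite !mxE; apply: dual_eq => /=; [exact: lx|exact: lw].
- apply/matrixP => i j; rewrite !mxE; apply: dual_eq.
    by rewrite dual_sum1 /= xM; apply: eq_bigr => r _; rewrite !mxE.
  by rewrite dual_sum2 /= wM; apply: eq_bigr => r _; rewrite !mxE.
- apply/matrixP => i j; rewrite !mxE; apply: dual_eq.
    rewrite dual_natr1; have := congr1 (fun M : 'M_N => M i j) (rep_idemE e phi alpha u).
    by rewrite !mxE.
  by rewrite dual_natr2 /= we.
- by apply/matrixP => i j; rewrite !mxE rep_phiE wphi.
Qed.

(** The Hamiltonian derivation of a single coordinate, extended in the second argument only. It is
    turned into data so that its dependence on a, i, j can then be checked against the same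
    relations. *)
Let Dgen a i j : {D : R -> R | derivation_along id D &
  forall b k l, D (x b k l) = c a i j b k l}.
Proof.
apply: cid2.
have [hD DE] := dual_lift (@alg_hom_id K R) (dual_rel (c_linear a i j)
  (c_mul a i j) (c_idem a i j) (fun b k l => c_phi a i j b l k)).
by eexists; [exact: hD|move=> b k l; exact: (DE (b, k, l))].
Qed.

Let D a i j : R -> R := s2val (Dgen a i j).
Let Dder a i j : derivation_along id (D a i j).
Proof. exact: (s2valP (Dgen a i j)). Qed.
Let DE a i j b k l : D a i j (x b k l) = c a i j b k l.
Proof. exact: (s2valP' (Dgen a i j)). Qed.

Let ext (L L' : R -> R) : derivation_along id L -> derivation_along id L' ->
  (forall a i j, L (x a i j) = L' (x a i j)) -> L =1 L'.
Proof. exact: (rep_derivation_ext (@alg_hom_id K R)). Qed.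

Let D_linear i j f : linear (fun a => D a i j f).
Proof.
move=> k a b; move: f; apply: ext => //.
  by apply: derivation_along_add => //; apply: derivation_along_scale.
move=> d u v; rewrite !DE c_anti c_linear opprD -scalerN.
by congr (_ *: _ + _); rewrite -c_anti.
Qed.

Let D_mul a b i j f :
  D (a * b) i j f = \sum_r (x a i r * D b r j f + D a i r f * x b r j).
Proof.
move: f; apply: ext => //.
  apply: derivation_along_sum => r; apply: derivation_along_add.
    exact: derivation_along_mull.
  exact: derivation_along_mulr.
move=> d u v; rewrite DE c_anti c_mul -sumrN; apply: eq_bigr => r _.
by rewrite !DE (c_anti d u v b) (c_anti d u v a) opprD mulrN mulNr.
Qed.

Let D_idem s i j f : D (e s) i j f = 0.
Proof.
move: f; apply: (ext (Dder _ _ _) (derivation_along0 _)) => b k l.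
by rewrite DE c_anti c_idem oppr0.
Qed.

Let D_phi a i j f : D (phi a) i j f = D a j i f.
Proof. by move: f; apply: ext => // b k l; rewrite !DE c_anti c_phi -c_anti. Qed.

(** For fixed f, the values [D a i j f] satisfy the linearized relations in a, because antisymmetry
    transfers those known in the other argument. They therefore extend to a derivation in the first
    slot. *)
Lemma rep_bracket_exists : exists br : R -> R -> R,
  antisym_biderivation br /\ forall a b i j k l, br (x a i j) (x b k l)
    = 2%:R^-1 *: ev2 x k j i l (dbr a b) + 2%:R^-1 *: ev2 x k i j l (dbr (phi a) b).
Proof.
have ex f : exists2 L : R -> R, derivation_along id L &
    forall a i j, L (x a i j) = D a i j f.
  have [hL LE] := dual_lift (@alg_hom_id K R) (dual_rel (fun i j => D_linear i j f)
    (fun a b i j => D_mul a b i j f) (fun s i j => D_idem s i j f)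
    (fun a i j => D_phi a i j f)).
  by eexists; [exact: hL|move=> a i j; exact: (LE (a, i, j))].
pose br g f := s2val (cid2 (ex f)) g.
have brl f : derivation_along id (br^~ f) by exact: (s2valP (cid2 (ex f))).
have brE a i j f : br (x a i j) f = D a i j f.
  exact: (s2valP' (cid2 (ex f))).
(* Each law in the second slot equates two derivations in the first, so it need only be checked at
   coordinates, where it is a law of [D a i j]. *)
have brr g : derivation_along id (br g).
  split=> [k u v|u v].
    move: g; apply: (ext (brl _)).
      by apply: derivation_along_add => //; apply: derivation_along_scale.
    by move=> a i j; rewrite !brE; have [-> _] := Dder a i j.
  move: g; apply: (ext (brl _)).
    apply: derivation_along_add; last exact: derivation_along_mull.
    exact: derivation_along_mulr.
  by move=> a i j; rewrite !brE; have [_ ->] := Dder a i j.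
have anti f g : br f g = - br g f.
  move: f; apply: (ext (brl _) (derivation_along_opp (brr _))) => a i j.
  move: g; apply: (ext (brr _) (derivation_along_opp (brl _))) => b k l.
  by rewrite !brE !DE c_anti.
exists br; split; last by move=> *; rewrite brE DE.
split=> //; first by split=> [f|g]; [have [] := brl f|have [] := brr g].
- by move=> f g h; have [_ ->] := brr f.
- by move=> f g h; have [_ ->] := brl h.
Qed.
End RepresentationBracket.

(** * Matrices over the dual numbers *)

Section EpsilonMatrices.
Variables (K : fieldType) (B : comPzAlgType K) (N : nat).
Implicit Types (P Q : 'M[B]_N) (xi : 'M[K]_N).

Definition inj_mx P : 'M[dual B]_N := map_mx (@dual_inj K B) P.
Definition eps_mx P : 'M[dual B]_N := map_mx (fun b => (0, b) : dual B) P.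

Lemma inj_mxM P Q : inj_mx (P *m Q) = inj_mx P *m inj_mx Q.
Proof.
have [lj [_ jM]] := dual_inj_hom B.
apply/matrixP => i j; rewrite !mxE (linear_fun_sum lj).
by apply: eq_bigr => r _; rewrite !mxE jM.
Qed.

Lemma inj_mx1 : inj_mx 1%:M = 1%:M.
Proof. by apply/matrixP => i j; rewrite !mxE; case: eqP. Qed.

Lemma inj_mx_tr P : (inj_mx P)^T = inj_mx P^T.
Proof. by apply/matrixP => i j; rewrite !mxE. Qed.

Lemma inj_eps_mxM P Q : inj_mx P *m eps_mx Q = eps_mx (P *m Q).
Proof.
apply/matrixP => i j; rewrite !mxE; apply: dual_eq.
  by rewrite dual_sum1 big1 // => r _; rewrite !mxE /= mulr0.
by rewrite dual_sum2; apply: eq_bigr => r _; rewrite !mxE /= mul0r addr0.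
Qed.

Lemma eps_inj_mxM P Q : eps_mx P *m inj_mx Q = eps_mx (P *m Q).
Proof.
apply/matrixP => i j; rewrite !mxE; apply: dual_eq.
  by rewrite dual_sum1 big1 // => r _; rewrite !mxE /= mul0r.
by rewrite dual_sum2; apply: eq_bigr => r _; rewrite !mxE /= mul0r add0r.
Qed.

Lemma eps_mxM P Q : eps_mx P *m eps_mx Q = 0.
Proof.
apply/matrixP => i j; rewrite !mxE big1 // => r _; rewrite !mxE.
by apply: dual_eq => /=; rewrite ?mul0r ?mulr0 ?addr0.
Qed.

Lemma eps_mxN P : eps_mx (- P) = - eps_mx P.
Proof. by apply/matrixP => i j; rewrite !mxE; apply: dual_eq => /=; rewrite ?oppr0. Qed.

Lemma exp_epsE xi : exp_eps B xi = 1%:M + eps_mx (in_alg_mx B xi).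
Proof. by apply/matrixP => i j; rewrite !mxE. Qed.

Lemma exp_epsN xi : exp_eps B (- xi) = 1%:M - eps_mx (in_alg_mx B xi).
Proof. by rewrite exp_epsE in_alg_mxN eps_mxN. Qed.

Lemma exp_epsVl xi : exp_eps B (- xi) *m exp_eps B xi = 1%:M.
Proof.
rewrite exp_epsN exp_epsE mulmxBl !mulmxDr !mul1mx !mulmx1 eps_mxM addr0.
by rewrite addrK.
Qed.

Lemma exp_epsVr xi : exp_eps B xi *m exp_eps B (- xi) = 1%:M.
Proof. by have := exp_epsVl (- xi); rewrite opprK. Qed.

Lemma exp_eps_tr xi : xi^T = - xi -> (exp_eps B xi)^T = exp_eps B (- xi).
Proof.
by move=> <-; apply/matrixP => i j; rewrite !mxE eq_sym.
Qed.

Lemma exp_eps_orthogonal xi :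
  xi^T = - xi -> (exp_eps B xi)^T *m exp_eps B xi = 1%:M.
Proof. by move=> /exp_eps_tr ->; apply: exp_epsVl. Qed.

Lemma exp_eps_conj xi P : exp_eps B (- xi) *m inj_mx P *m exp_eps B xi
  = inj_mx P + eps_mx (P *m in_alg_mx B xi - in_alg_mx B xi *m P).
Proof.
have epsD (Q Q' : 'M[B]_N) : eps_mx (Q + Q') = eps_mx Q + eps_mx Q'.
  by apply/matrixP => i j; rewrite !mxE; apply: dual_eq => /=; rewrite ?addr0.
rewrite exp_epsN exp_epsE mulmxBl mul1mx eps_inj_mxM mulmxDr mulmx1 mulmxBl.
by rewrite inj_eps_mxM eps_mxM subr0 epsD eps_mxN addrAC addrA.
Qed.
End EpsilonMatrices.

Section BlockDiagonal.
Variables (n : nat) (alpha : 'I_n -> nat).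
Local Notation N := (total_dim alpha).

Definition off_block_zero (B : pzRingType) (P : 'M[B]_N) :=
  forall i j, ~~ same_block i j -> P i j = 0.

Lemma same_block_refl (i : 'I_N) : same_block i i.
Proof. by have [s si] := in_block_exists i; apply/existsP; exists s; rewrite si. Qed.

Lemma same_block_trans (j i k : 'I_N) :
  same_block i j -> same_block j k -> same_block i k.
Proof.
move=> /existsP[s /andP[si sj]] /existsP[t /andP[tj tk]].
by apply/existsP; exists s; rewrite si (in_block_inj sj tj) tk.
Qed.

Lemma off_block_zero1 (B : pzRingType) : off_block_zero (1%:M : 'M[B]_N).
Proof. by move=> i j; rewrite mxE; case: eqP => // ->; rewrite same_block_refl. Qed.

Lemma off_block_zeroM (B : pzRingType) (P Q : 'M[B]_N) :
  off_block_zero P -> off_block_zero Q -> off_block_zero (P *m Q).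
Proof.
move=> hP hQ i j ij; rewrite mxE big1 // => r _.
have [ir|/hP ->] := boolP (same_block i r); last by rewrite mul0r.
rewrite hQ ?mulr0 //; apply: contra ij; exact: same_block_trans.
Qed.

Lemma off_block_zero_tr (B : pzRingType) (P : 'M[B]_N) :
  off_block_zero P -> off_block_zero P^T.
Proof. by move=> hP i j; rewrite mxE same_block_sym; apply: hP. Qed.

Lemma off_block_zero_in_alg (K : fieldType) (B : comPzAlgType K) (P : 'M[K]_N) :
  block_diagonal P -> off_block_zero (in_alg_mx B P).
Proof. by move=> hP i j /hP; rewrite mxE => ->; rewrite scale0r. Qed.

Lemma off_block_zero_exp_eps (K : fieldType) (B : comPzAlgType K) (xi : 'M[K]_N) :
  block_diagonal xi -> off_block_zero (exp_eps B xi).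
Proof.
move=> hxi i j ij; rewrite mxE (off_block_zero1 _ ij) mxE (hxi _ _ ij) scale0r.
by rewrite add0r.
Qed.

Lemma O_alpha_mulmxV (K : fieldType) (g : 'M[K]_N) : O_alpha g -> g *m g^T = 1%:M.
Proof. by move=> [_ /mulmx1C]. Qed.

Lemma O_alpha_invmx (K : fieldType) (g : 'M[K]_N) : O_alpha g -> invmx g = g^T.
Proof.
move=> hg; have [_ gTg] := hg; have [ug _] := mulmx1_unit (O_alpha_mulmxV hg).
by rewrite -[LHS]mul1mx -gTg -mulmxA mulmxV // mulmx1.
Qed.
End BlockDiagonal.

(** * The group and infinitesimal actions on the coordinate ring *)

Section RepresentationActions.
Variables (K : fieldType) (A : pzAlgType K) (n : nat) (e : 'I_n -> A).
Variables (phi : A -> A) (alpha : 'I_n -> nat).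
Local Notation N := (total_dim alpha).
Local Notation R := (rep_phi_ring e phi alpha).
Local Notation rel := (@rep_phi_rel K A n e phi alpha).
Local Notation x := (a_ e phi (alpha := alpha)).
Local Notation X := (X_ e phi alpha).
Local Notation act := (@rep_action K A n e phi alpha).
Local Notation inf := (@rep_inf_action K A n e phi alpha).

Lemma rep_action_rel (g : 'M[K]_N) : O_alpha g ->
  let v (z : A * 'I_N * 'I_N) :=
    (in_alg_mx R (invmx g) *m X z.1.1 *m in_alg_mx R g) z.1.2 z.2 in
  forall s t, rel s t -> peval v s = peval v t.
Proof.
move=> hg v; have [gb gTg] := hg.
have -> : v = fun z =>
    (in_alg_mx R (invmx g) *m map_mx id (X z.1.1) *m in_alg_mx R g) z.1.2 z.2.
  by apply/funext => z; rewrite map_mx_id.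
rewrite (O_alpha_invmx hg); apply: conj_rep_phi_rel.
- exact: alg_hom_id.
- by rewrite -in_alg_mxM (O_alpha_mulmxV hg) in_alg_mx1.
- by rewrite -in_alg_mxM gTg in_alg_mx1.
- exact: in_alg_mx_tr.
- move=> t; apply: block_diagonal_comm; exact: off_block_zero_in_alg.
Qed.

Lemma rep_action_hom (g : 'M[K]_N) : O_alpha g -> alg_hom (act g).
Proof. by move=> hg; apply/plift_alg_hom/rep_action_rel. Qed.

Lemma rep_actionE (g : 'M[K]_N) a i j : O_alpha g ->
  act g (x a i j) = (in_alg_mx R g^T *m X a *m in_alg_mx R g) i j.
Proof.
move=> hg; rewrite -(O_alpha_invmx hg).
exact: (plift_gen (a, i, j) (rep_action_rel hg)).
Qed.

(** For xi in o_alpha, 1 + eps xi is orthogonal and block diagonal over the dual numbers, so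
    conjugation by it respects the relations; its eps-part is [X(a), xi]. *)
Lemma rep_inf_action_spec (xi : 'M[K]_N) : o_alpha xi ->
  derivation_along id (inf xi) /\ forall a i j,
    inf xi (x a i j) = \tr (in_alg_mx R xi *m grad_mx (\matrix_(i, j) x a i j) i j).
Proof.
move=> [xib xiT].
pose w (z : A * 'I_N * 'I_N) :=
  (X z.1.1 *m in_alg_mx R xi - in_alg_mx R xi *m X z.1.1) z.1.2 z.2.
have conjE : (fun z : A * 'I_N * 'I_N => (exp_eps R (- xi)
      *m map_mx (@dual_inj K R) (X z.1.1) *m exp_eps R xi) z.1.2 z.2)
    = (fun z => (gen rel z, w z) : dual R).
  apply/funext => -[[a i] j] /=; rewrite -/(inj_mx _) exp_eps_conj mxE.
  apply: dual_eq; rewrite /= [inj_mx _ i j]mxE [eps_mx _ i j]mxE /=.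
    by rewrite addr0 mxE.
  by rewrite add0r.
have [|hD DE] := @dual_lift _ _ rel R id w (@alg_hom_id _ _).
  move=> s t st; congr eps_coef; move: s t st; rewrite -conjE.
  apply: conj_rep_phi_rel.
  - exact: dual_inj_hom.
  - exact: exp_epsVr.
  - exact: exp_epsVl.
  - exact: exp_eps_tr.
  - move=> t; apply: block_diagonal_comm; exact: off_block_zero_exp_eps.
have infE : inf xi = fun f =>
    eps_coef (plift (S := dual R) (fun z => (gen rel z, w z)) f).
  by apply/funext => f; rewrite /rep_inf_action conjE.
split=> [|a i j]; first by rewrite infE.
rewrite infE mxtrace_grad; exact: (DE (a, i, j)).
Qed.
End RepresentationActions.

Section AlgHomMatrix.
Variables (K : fieldType) (B C : comPzAlgType K) (f : B -> C).
Hypothesis hf : alg_hom f.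

Lemma alg_hom_mulmx m n p (P : 'M[B]_(m, n)) (Q : 'M[B]_(n, p)) :
  map_mx f (P *m Q) = map_mx f P *m map_mx f Q.
Proof.
have [lf [_ fM]] := hf; apply/matrixP => i j; rewrite !mxE (linear_fun_sum lf).
by apply: eq_bigr => r _; rewrite fM !mxE.
Qed.

Lemma alg_hom_in_alg_mx N (P : 'M[K]_N) : map_mx f (in_alg_mx B P) = in_alg_mx C P.
Proof.
by have [lf [f1 _]] := hf; apply/matrixP => i j; rewrite !mxE (linear_funZ lf) f1.
Qed.

Lemma alg_hom_conj N (P Q : 'M[K]_N) (U : 'M[B]_N) V i j : map_mx f U = V ->
  f ((in_alg_mx B P *m U *m in_alg_mx B Q) i j)
  = (in_alg_mx C P *m V *m in_alg_mx C Q) i j.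
Proof. by move=> <-; rewrite -!alg_hom_in_alg_mx -!alg_hom_mulmx [RHS]mxE. Qed.

Lemma alg_hom_anticommutator N (P : 'M[K]_N) (U : 'M[B]_N) V i j : map_mx f U = V ->
  f ((U *m in_alg_mx B P) i j + (in_alg_mx B P *m U) i j)
  = (V *m in_alg_mx C P + in_alg_mx C P *m V) i j.
Proof.
have [lf _] := hf; move=> <-.
by rewrite -!alg_hom_in_alg_mx -!alg_hom_mulmx (linear_funD lf) !mxE.
Qed.
End AlgHomMatrix.

(** * The coordinate ring of O_alpha and its invariant vector fields *)

Section OrthogonalGroupRing.
Variables (K : fieldType) (n : nat) (alpha : 'I_n -> nat).
Local Notation N := (total_dim alpha).
Local Notation H := (O_ring K alpha).
Local Notation rel := (@O_rel K n alpha).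
Local Notation U := (O_coord K alpha).

Lemma peval_O_rel (C : comPzAlgType K) (P : 'M[C]_N) :
  off_block_zero P -> P^T *m P = 1%:M ->
  forall s t, rel s t -> peval (fun z => P z.1 z.2) s = peval (fun z => P z.1 z.2) t.
Proof.
move=> Pb PTP s t [i j ij|i j] /=; first by rewrite Pb // scale0r.
rewrite peval_big /=.
have := congr1 (fun M : 'M_N => M i j) PTP; rewrite !mxE scaler_nat => <-.
by apply: eq_bigr => r _; rewrite mxE.
Qed.

Lemma O_rel_eq s t : rel s t -> peval (gen rel) s = peval (gen rel) t.
Proof.
move=> st; have /= E r := peval_gen r (@alg_hom_id K (presented rel)).
by rewrite !E; apply/pclassE/pc_rel.
Qed.

Lemma O_coord_block : off_block_zero U.
Proof.
move=> i j ij; rewrite mxE; apply: etrans (O_rel_eq (O_block K ij)) _.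
by rewrite /= scale0r.
Qed.

Lemma O_coord_orthogonal : U^T *m U = 1%:M.
Proof.
apply/matrixP => i j; rewrite [RHS]mxE -(scaler_nat _ (1 : H)).
apply: etrans (O_rel_eq (O_orth K i j)); rewrite peval_big mxE.
by apply: eq_bigr => r _; rewrite !mxE.
Qed.

Lemma O_adjoint_rel (g : 'M[K]_N) : O_alpha g ->
  let v (z : 'I_N * 'I_N) := (in_alg_mx H (invmx g) *m U *m in_alg_mx H g) z.1 z.2 in
  forall s t, rel s t -> peval v s = peval v t.
Proof.
move=> hg v; have [gb gTg] := hg.
apply: (@peval_O_rel H (in_alg_mx H (invmx g) *m U *m in_alg_mx H g));
  rewrite (O_alpha_invmx hg) -in_alg_mx_tr.
- apply: off_block_zeroM; last exact: off_block_zero_in_alg.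
  apply: off_block_zeroM; last exact: O_coord_block.
  exact/off_block_zero_tr/off_block_zero_in_alg.
- have ginv : in_alg_mx H g *m (in_alg_mx H g)^T = 1%:M.
    by rewrite in_alg_mx_tr -in_alg_mxM (O_alpha_mulmxV hg) in_alg_mx1.
  apply: orthogonal_mulmx; last by rewrite in_alg_mx_tr -in_alg_mxM gTg in_alg_mx1.
  by apply: orthogonal_mulmx O_coord_orthogonal; rewrite trmxK.
Qed.

Lemma O_adjoint_hom (g : 'M[K]_N) : O_alpha g -> alg_hom (@O_adjoint K n alpha g).
Proof. by move=> hg; apply/plift_alg_hom/O_adjoint_rel. Qed.

Lemma O_adjointE (g : 'M[K]_N) i j : O_alpha g ->
  O_adjoint g (U i j) = (in_alg_mx H g^T *m U *m in_alg_mx H g) i j.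
Proof.
move=> hg; rewrite -(O_alpha_invmx hg) mxE.
exact: (plift_gen (i, j) (O_adjoint_rel hg)).
Qed.

(** A tangent vector at the universal point of O_alpha, written as a block diagonal orthogonal
    matrix over the dual numbers, is a derivation of the coordinate ring. *)
Lemma dual_O_rel (P : 'M[H]_N) (V : 'M[dual H]_N) :
  V = inj_mx U + eps_mx P -> off_block_zero V -> V^T *m V = 1%:M ->
  let D f := eps_coef (plift (S := dual H) (rel := rel) (fun z => V z.1 z.2) f) in
  derivation_along id D /\ forall i j, D (U i j) = P i j.
Proof.
move=> VE Vb VTV.
have E : (fun z : 'I_N * 'I_N => V z.1 z.2)
    = (fun z => (gen rel z, P z.1 z.2) : dual H).
  apply/funext => -[i j] /=; rewrite VE mxE.
  by apply: dual_eq; rewrite !mxE /= ?addr0 ?add0r.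
have [|hD DE] := @dual_lift _ _ rel H id (fun z => P z.1 z.2) (@alg_hom_id _ _).
  by rewrite -E => s t st; rewrite (peval_O_rel Vb VTV st).
by rewrite E; split=> // i j; rewrite mxE; exact: (DE (i, j)).
Qed.

Lemma inj_O_coord_orthogonal : (inj_mx U)^T *m inj_mx U = 1%:M.
Proof. by rewrite inj_mx_tr -inj_mxM O_coord_orthogonal inj_mx1. Qed.

Lemma off_block_zero_inj_O_coord : off_block_zero (inj_mx U).
Proof. by move=> i j ij; rewrite mxE O_coord_block. Qed.

Lemma O_left_spec (xi : 'M[K]_N) : o_alpha xi ->
  derivation_along id (@O_left K n alpha xi)
  /\ forall i j, O_left xi (U i j) = (U *m in_alg_mx H xi) i j.
Proof.
move=> [xib xiT]; apply: dual_O_rel.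
- by rewrite exp_epsE mulmxDr mulmx1 inj_eps_mxM.
- exact: off_block_zeroM off_block_zero_inj_O_coord (off_block_zero_exp_eps _ xib).
- exact: orthogonal_mulmx inj_O_coord_orthogonal (exp_eps_orthogonal _ xiT).
Qed.

Lemma O_right_spec (xi : 'M[K]_N) : o_alpha xi ->
  derivation_along id (@O_right K n alpha xi)
  /\ forall i j, O_right xi (U i j) = (in_alg_mx H xi *m U) i j.
Proof.
move=> [xib xiT]; apply: dual_O_rel.
- by rewrite exp_epsE mulmxDl mul1mx eps_inj_mxM.
- exact: off_block_zeroM (off_block_zero_exp_eps _ xib) off_block_zero_inj_O_coord.
- exact: orthogonal_mulmx (exp_eps_orthogonal _ xiT) inj_O_coord_orthogonal.
Qed.
End OrthogonalGroupRing.

(** * Invariance of the bracket *)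

Section Equivariance.
Variables (K : fieldType) (A : pzAlgType K) (n : nat) (e : 'I_n -> A).
Variables (dbr : A -> A -> tensor A A) (phi : A -> A) (alpha : 'I_n -> nat).
Local Notation N := (total_dim alpha).
Local Notation R := (rep_phi_ring e phi alpha).
Local Notation x := (a_ e phi (alpha := alpha)).
Local Notation act := (@rep_action K A n e phi alpha).
Variable br : R -> R -> R.
Hypothesis hbr : antisym_biderivation br.
Hypothesis brE : forall a b i j k l, br (x a i j) (x b k l)
  = 2%:R^-1 *: ev2 x k j i l (dbr a b) + 2%:R^-1 *: ev2 x k i j l (dbr (phi a) b).
Variable g : 'M[K]_N.
Hypothesis hg : O_alpha g.

(** Since the inverse of g is its transpose, both indices transform in the same way. This is what
    makes the term with i and j interchanged equivariant as well. *)
Lemma rep_action_sum a i j :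
  act g (x a i j) = \sum_p \sum_q (g p i * g q j) *: x a p q.
Proof.
rewrite rep_actionE // mxE exchange_big; apply: eq_bigr => q _.
rewrite mxE mulr_suml; apply: eq_bigr => p _; rewrite !mxE.
by rewrite -pzscalerAr mulr1 -pzscalerAl mul1r scalerA mulrC.
Qed.

Lemma rep_action_ev2 k j i l d : act g (ev2 x k j i l d)
  = \sum_p \sum_q \sum_r \sum_s
      (g p i * g q j * (g r k * g s l)) *: ev2 x r q p s d.
Proof.
have lx := rep_linear e phi (alpha := alpha).
have [lact [_ actM]] := rep_action_hom e phi hg.
move: d; apply: tensor_ext => [||a b].
- exact: linear_comp lact (ev2_linear lx _ _ _ _).
- do 4! (apply: linear_sum => ?); apply: linear_scaler; exact: ev2_linear.
rewrite (ev2_pure lx) actM !rep_action_sum exchange_big /= mulrC mulr_suml.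
apply: eq_bigr => p _; rewrite mulr_sumr; apply: eq_bigr => q _.
rewrite mulrC mulr_suml; apply: eq_bigr => r _; rewrite mulr_sumr.
apply: eq_bigr => s _; rewrite (ev2_pure lx) -pzscalerAl -pzscalerAr scalerA.
by congr (_ *: _); ring.
Qed.

Lemma rep_action_bracket f h : br (act g f) (act g h) = act g (br f h).
Proof.
have hact := rep_action_hom e phi hg; have [lact _] := hact.
have ext := rep_derivation_ext hact.
have [hbil _ _ _] := hbr.
move: h; apply: (ext).
- exact: derivation_along_comp hact (biderivation_r _ hbr).
- exact: derivation_along_post hact (biderivation_r _ hbr).
move=> b k l; move: f; apply: (ext).
- exact: derivation_along_comp hact (biderivation_l _ hbr).
- exact: derivation_along_post hact (biderivation_l _ hbr).
move=> a i j; rewrite brE (linear_funD lact) !(linear_funZ lact) !rep_action_ev2.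
(* Exchanging the sums over p and q in the twisted term undoes its interchange of i and j, so the
   coefficients of the two halves agree. *)
rewrite [X in _ + _ *: X]exchange_big /= -scalerDr -big_split !rep_action_sum.
rewrite (bilin_sum2 _ _ _ _ hbil) scaler_sumr; apply: eq_bigr => p _ /=.
rewrite -big_split scaler_sumr; apply: eq_bigr => q _ /=.
rewrite -big_split scaler_sumr; apply: eq_bigr => r _ /=.
rewrite -big_split scaler_sumr; apply: eq_bigr => s _ /=.
by rewrite brE [g q j * _]mulrC -scalerDr -scalerDr !scalerA mulrC.
Qed.
End Equivariance.

(** * Uniqueness, quasi-Poisson property and moment map for the representation scheme *)

Section MomentMapRepresentation.
Variables (K : fieldType) (A : pzAlgType K) (n : nat) (e : 'I_n -> A).
Variables (dbr : A -> A -> tensor A A) (phi : A -> A) (alpha : 'I_n -> nat).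
Local Notation N := (total_dim alpha).
Local Notation R := (rep_phi_ring e phi alpha).
Local Notation H := (O_ring K alpha).
Local Notation x := (a_ e phi (alpha := alpha)).
Local Notation act := (@rep_action K A n e phi alpha).
Local Notation inf := (@rep_inf_action K A n e phi alpha).
Hypothesis he : idempotent_decomposition e.
Hypothesis hdbr : double_quasi_poisson e dbr.
Hypothesis hphi : compatible_involution e dbr phi.
Hypothesis nz12 : 12%:R != 0 :> K.
Variable br : R -> R -> R.
Hypothesis hbr : antisym_biderivation br.
Hypothesis brE : forall a b i j k l, br (x a i j) (x b k l)
  = 2%:R^-1 *: ev2 x k j i l (dbr a b) + 2%:R^-1 *: ev2 x k i j l (dbr (phi a) b).

Let lx := rep_linear e phi (alpha := alpha).
Let xM := rep_mulE e phi (alpha := alpha).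
Let xe := rep_idemE e phi alpha.
Let xphi := rep_phiE e phi (alpha := alpha).
Let x_ext (D D' : R -> R) : derivation_along id D -> derivation_along id D' ->
  (forall a i j, D (x a i j) = D' (x a i j)) -> D =1 D'.
Proof. exact: (rep_derivation_ext (@alg_hom_id K R)). Qed.
Let inf_der xi : o_alpha xi -> derivation_along id (inf xi).
Proof. by move=> hxi; have [] := rep_inf_action_spec e phi hxi. Qed.
Let infE xi : o_alpha xi -> forall a i j,
  inf xi (x a i j) = \tr (in_alg_mx R xi *m grad_mx (\matrix_(i, j) x a i j) i j).
Proof. by move=> hxi; have [] := rep_inf_action_spec e phi hxi. Qed.

Lemma rep_bracket_unique (br' : R -> R -> R) : antisym_biderivation br' ->
  (forall a b i j k l, br' (x a i j) (x b k l)
    = 2%:R^-1 *: ev2 x k j i l (dbr a b) + 2%:R^-1 *: ev2 x k i j l (dbr (phi a) b)) ->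
  br' = br.
Proof.
move=> hbr' brE'; apply/funext => f; apply/funext => h.
move: f; apply: x_ext; [exact: biderivation_l|exact: biderivation_l|move=> a i j].
move: h; apply: x_ext; [exact: biderivation_r|exact: biderivation_r|move=> b k l].
by rewrite brE brE'.
Qed.

Lemma rep_quasi_poisson : quasi_poisson (@O_alpha n alpha K) (@o_alpha n alpha K) act inf br.
Proof.
split=> //; first by move=> g hg f h; apply: rep_action_bracket.
move=> m F F' hF f g h.
exact: (jacobi_cartan_trivector he hdbr hphi lx xM xe xphi hbr brE x_ext inf_der
  infE nz12 hF).
Qed.

Variable Phi : A.
Hypothesis hPhi : double_moment_map e dbr Phi.
Hypothesis PhiK : phi Phi * Phi = 1.

Let Phi_rel s t : @O_rel K n alpha s t ->
  peval (fun z => X_ e phi alpha Phi z.1 z.2) s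
  = peval (fun z => X_ e phi alpha Phi z.1 z.2) t.
Proof.
apply: peval_O_rel.
  move=> i j ij; rewrite mxE.
  exact: (moment_map_same_block he lx xM xe hPhi ij).
exact: (moment_orthogonal he lx xM xe xphi PhiK).
Qed.

Let Xi : H -> R := plift (fun z => X_ e phi alpha Phi z.1 z.2).

Let hXi : alg_hom Xi. Proof. exact: plift_alg_hom. Qed.

Let XiE i j : Xi (O_coord K alpha i j) = x Phi i j.
Proof. by rewrite mxE; apply: etrans (plift_gen (i, j) Phi_rel) _; rewrite mxE. Qed.

Let XiU : map_mx Xi (O_coord K alpha) = X_ e phi alpha Phi.
Proof. by apply/matrixP => i j; rewrite mxE XiE mxE. Qed.

Let gen_O_coord i j : gen (@O_rel K n alpha) (i, j) = O_coord K alpha i j.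
Proof. by rewrite mxE. Qed.

Lemma rep_moment_map_equivariant g u : O_alpha g -> Xi (O_adjoint g u) = act g (Xi u).
Proof.
move=> hg; have hact := rep_action_hom e phi hg; have hadj := O_adjoint_hom hg.
move: u; apply: (alg_hom_ext (alg_hom_comp hXi hadj) (alg_hom_comp hact hXi)) => -[i j].
rewrite gen_O_coord [LHS]/= [RHS]/= O_adjointE // XiE rep_actionE //.
exact: (alg_hom_conj hXi _ _ _ _ XiU).
Qed.

Lemma rep_moment_map_bracket m (F F' : m.-tuple 'M[K]_N) u f :
  trace_dual_bases (@o_alpha n alpha K) F F' -> br (Xi u) f = 2%:R^-1 *:
    \sum_a Xi (O_left (tnth F a) u + O_right (tnth F a) u) * inf (tnth F' a) f.
Proof.
move=> hF; have [_ spanF _ _] := hF.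
have oF a : o_alpha (tnth F a) by apply/spanF/memv_span/mem_tnth.
have LRder a : derivation_along (Xi \o id)
    (Xi \o (fun u => O_left (tnth F a) u + O_right (tnth F a) u)).
  apply: (derivation_along_post hXi).
  have [hL _] := O_left_spec (oF a); have [hR _] := O_right_spec (oF a).
  exact: (derivation_along_add hL hR).
have lhs_der := derivation_along_comp hXi (biderivation_l f hbr).
have rhs_der := derivation_along_scale (2%:R^-1) (derivation_along_sum (index_enum _)
  (fun a => derivation_along_mulr (inf (tnth F' a) f) (LRder a))).
move: u; apply: (derivation_along_ext hXi lhs_der rhs_der) => -[i j].
rewrite gen_O_coord [LHS]/= XiE.
rewrite (moment_map_bracket he hdbr lx xM xe xphi hbr brE x_ext inf_der infE nz12
  hF hPhi PhiK).
congr (_ *: _); apply: eq_bigr => a _; congr (_ * _).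
have [_ LE] := O_left_spec (oF a); have [_ RE] := O_right_spec (oF a).
rewrite [RHS]/= LE RE; exact/esym/(alg_hom_anticommutator hXi _ _ _ XiU).
Qed.

Lemma rep_moment_map : exists Xi : H -> R,
  (forall i j, Xi (O_coord K alpha i j) = X_ e phi alpha Phi i j) /\
  moment_map (@O_alpha n alpha K) (@o_alpha n alpha K) act inf
    (@O_adjoint K n alpha) (@O_left K n alpha) (@O_right K n alpha) br Xi.
Proof.
exists Xi; split; first by move=> i j; rewrite XiE mxE.
split; first exact: hXi.
- by move=> g hg u; apply: rep_moment_map_equivariant.
- by move=> m F F' hF u f; apply: rep_moment_map_bracket.
Qed.
End MomentMapRepresentation.

Theorem theorem4p6 (R : realType) (n : nat) (A : pzAlgType R[i]) (e : 'I_n -> A)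
  (dbr : A -> A -> tensor A A) (phi : A -> A) (alpha : 'I_n -> nat)
  (hA : finitely_generated A)
  (he : idempotent_decomposition e)
  (hdbr : double_quasi_poisson e dbr)
  (hphi : compatible_involution e dbr phi) :
  let B := rep_phi_ring e phi alpha in
  let bracket_formula (br : B -> B -> B) := forall a b i j k l,
    br (a_ e phi a i j) (a_ e phi b k l)
    = 2%:R^-1 *: coord2 e phi k j i l (dbr a b)
      + 2%:R^-1 *: coord2 e phi k i j l (dbr (phi a) b) in
  exists br : B -> B -> B,
    [/\ antisym_biderivation br /\ bracket_formula br,
        forall br' : B -> B -> B,
          antisym_biderivation br' -> bracket_formula br' -> br' = br,
        quasi_poisson (@O_alpha n alpha R[i]) (@o_alpha n alpha R[i])
          (@rep_action _ A n e phi alpha) (@rep_inf_action _ A n e phi alpha) br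
      & forall Phi : A, double_moment_map e dbr Phi -> phi Phi * Phi = 1 ->
        exists Xi : O_ring R[i] alpha -> B,
          (forall i j, Xi (O_coord R[i] alpha i j) = X_ e phi alpha Phi i j) /\
          moment_map (@O_alpha n alpha R[i]) (@o_alpha n alpha R[i])
            (@rep_action _ A n e phi alpha) (@rep_inf_action _ A n e phi alpha)
            (@O_adjoint R[i] n alpha) (@O_left R[i] n alpha)
            (@O_right R[i] n alpha) br Xi].
Proof.
move=> B bracket_formula.
(* Nonvanishing of 12 supplies both the 1/2 of the projection and the 1/12 of the Cartan
   trivector. *)
have nz12 : 12%:R != 0 :> R[i] by rewrite Num.Theory.pnatr_eq0.
(* [coord2] is convertible to [ev2] at the coordinate functions, so [brE] is already the required
   formula. *)
have [br [hbr brE]] := rep_bracket_exists alpha (proj1 hdbr) hphi.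
exists br; split.
- exact: (conj hbr brE).
- by move=> br' hbr' brE'; apply: (rep_bracket_unique hbr brE hbr' brE').
- exact: (rep_quasi_poisson he hdbr hphi nz12 hbr brE).
- by move=> Phi hPhi PhiK; apply: (rep_moment_map he hdbr nz12 hbr brE hPhi PhiK).
Qed.
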